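(* Let $z>y\ge1$ be integers and $0\le\alpha<1$ be such that the $(\alpha,z,y)$-Johnson Coverage$^*$ problem is NP-hard. Then for every constant $\varepsilon>0$ there is a constant $\rho>0$ such that, given as input a point-set $\mathcal{P}\subset\{0,1\}^d$ of size $n$ (with $d=O(\log n)$) and a parameter $k$, it is NP-hard to distinguish between the following two cases: - Completeness: there exist $\mathcal{C}'=\{c_1,\dots,c_k\}\subseteq\{0,1\}^d$ and $\sigma:\mathcal{P}\to\mathcal{C}'$ such that $\sum_{a\in\mathcal{P}}\|a-\sigma(a)\|_0\le\rho\, n\log n$. - Soundness: for every $\mathcal{C}'=\{c_1,\dots,c_k\}\subseteq\{0,1\}^d$ and every $\sigma:\mathcal{P}\to\mathcal{C}'$, $\sum_{a\in\mathcal{P}}\|a-\sigma(a)\|_0\ge\left(1+\frac{1-\alpha}{z-y}-\varepsilon\right)\cdot\rho\, n\log n$.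
   Context: $\|a-b\|_0$ denotes the number of coordinates on which $a$ and $b$ differ. $(\alpha,z,y)$-Johnson Coverage problem ($z>y\ge1$): given a universe $U=[n]=\{1,\dots,n\}$, a collection $E\subseteq\binom{[n]}{z}$ of $z$-element subsets, and a parameter $k$, distinguish between: (Completeness) there are $S_1,\dots,S_k\in\binom{[n]}{y}$ such that every $T\in E$ contains some $S_i$; (Soundness) for all $S_1,\dots,S_k\in\binom{[n]}{y}$, the number of $T\in E$ containing at least one $S_i$ is at most $\alpha|E|$. The $(\alpha,z,y)$-Johnson Coverage$^*$ problem is its special case restricted to instances satisfying $|E|=\omega(k\cdot|U|^{z-y-1})$. *)

(* Defs.v *)
From mathcomp Require Import all_boot all_order all_algebra.
From mathcomp Require Import reals exp.

Set Implicit Arguments.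
Unset Strict Implicit.
Unset Printing Implicit Defensive.

Import Order.TTheory GRing.Theory Num.Theory.

(* Model of computation: a structured imperative language over binary trees
   (a WHILE language in the style of Jones), with an explicit time cost.
   An assignment is charged the size of the stored tree, a test costs one
   unit.  With unit-cost assignments, iterating x := Node x x would build a tree
   of exponential size in polynomial time; with the charge below, the total size
   of the store is at most the input size plus a program-dependent constant plus
   the time spent, so that polynomial time in this model coincides with
   polynomial time on Turing machines. *)

Inductive tree := Leaf | Node of tree & tree.

Fixpoint tsize (t : tree) : nat :=
  if t is Node l r then (tsize l + tsize r).+1 else 1.

Definition tleft (t : tree) : tree := if t is Node l _ then l else Leaf.
Definition tright (t : tree) : tree := if t is Node _ r then r else Leaf.
Definition is_node (t : tree) : bool := if t is Node _ _ then true else false.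

Inductive expr :=
| EVar of nat
| ELeaf
| ENode of expr & expr
| ELeft of expr
| ERight of expr.

Inductive cmd :=
| Skip
| Assign of nat & expr
| Seq of cmd & cmd
| If of nat & cmd & cmd
| While of nat & cmd.

Definition store := nat -> tree.

Definition update (s : store) (x : nat) (t : tree) : store :=
  fun y => if y == x then t else s y.

Fixpoint eval (s : store) (e : expr) : tree :=
  match e with
  | EVar x => s x
  | ELeaf => Leaf
  | ENode e1 e2 => Node (eval s e1) (eval s e2)
  | ELeft e1 => tleft (eval s e1)
  | ERight e1 => tright (eval s e1)
  end.

(* [exec s c s' t]: from [s], the command [c] terminates in [s'] at cost [t]. *)
Inductive exec : store -> cmd -> store -> nat -> Prop :=
| ExecSkip s : exec s Skip s 1
| ExecAssign s x e :
    exec s (Assign x e) (update s x (eval s e)) (tsize (eval s e))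
| ExecSeq s1 s2 s3 c1 c2 t1 t2 :
    exec s1 c1 s2 t1 -> exec s2 c2 s3 t2 -> exec s1 (Seq c1 c2) s3 (t1 + t2)
| ExecIfTrue s s' x c1 c2 t :
    is_node (s x) -> exec s c1 s' t -> exec s (If x c1 c2) s' t.+1
| ExecIfFalse s s' x c1 c2 t :
    ~~ is_node (s x) -> exec s c2 s' t -> exec s (If x c1 c2) s' t.+1
| ExecWhileFalse s x c :
    ~~ is_node (s x) -> exec s (While x c) s 1
| ExecWhileTrue s1 s2 s3 x c t1 t2 :
    is_node (s1 x) -> exec s1 c s2 t1 -> exec s2 (While x c) s3 t2 ->
    exec s1 (While x c) s3 (t1 + t2).+1.

(* Input and output are passed in variable 0. *)
Definition init (t : tree) : store := fun x => if x == 0 then t else Leaf.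

Definition polytime (A B : Type) (encA : A -> tree) (encB : B -> tree)
    (f : A -> B) : Prop :=
  exists (c : cmd) (m : nat), forall a : A,
    exists (s : store) (t : nat),
      [/\ exec (init (encA a)) c s t,
          s 0 = encB (f a) &
          t <= m * tsize (encA a) ^ m].

Definition enc_bool (b : bool) : tree := if b then Node Leaf Leaf else Leaf.

(* Unary: the numeric parameters of the problems below are part of the size of
   an instance. *)
Definition enc_nat (n : nat) : tree := iter n (Node Leaf) Leaf.

Definition enc_seq (A : Type) (encA : A -> tree) (s : seq A) : tree :=
  foldr (fun a t => Node (encA a) t) Leaf s.

Definition enc_bits : seq bool -> tree := enc_seq enc_bool.

Definition enc_bits_pair (p : seq bool * seq bool) : tree :=
  Node (enc_bits p.1) (enc_bits p.2).

Definition in_NP (L : seq bool -> Prop) : Prop :=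
  exists (V : seq bool * seq bool -> bool) (m : nat),
    polytime enc_bits_pair enc_bool V /\
    forall x : seq bool,
      L x <-> exists w : seq bool, size w <= m * (size x).+1 ^ m /\ V (x, w).

(* NP-hardness (under polynomial-time many-one reductions) of distinguishing
   the instances satisfying [yes] from those satisfying [no]. *)
Definition NP_hard (I : Type) (enc : I -> tree) (yes no : I -> Prop) : Prop :=
  forall L : seq bool -> Prop, in_NP L ->
    exists f : seq bool -> I,
      [/\ polytime enc_bits enc f,
          forall x, L x -> yes (f x) &
          forall x, ~ L x -> no (f x)].

(* The universe [n] is rendered as 'I_n, and the collection of sets as a list,
   in arbitrary order, required to be duplicate-free in [jc_promise]. *)
Record jc_instance := JCInstance {
  jc_univ : nat;
  jc_sets : seq {set 'I_jc_univ};
  jc_k : nat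
}.

Definition enc_jc (I : jc_instance) : tree :=
  Node (enc_nat (jc_univ I))
    (Node (enc_seq (fun T : {set 'I_(jc_univ I)} =>
                      enc_seq (fun i : 'I_(jc_univ I) => enc_nat i) (enum T))
                   (jc_sets I))
          (enc_nat (jc_k I))).

Definition tends_to_infinity (g : nat -> nat) : Prop :=
  forall C : nat, exists N : nat, forall n : nat, N <= n -> C <= g n.

(* The last clause, for a fixed [g] tending to infinity, is the condition
   |E| = omega(k |U|^(z-y-1)).  If E were allowed to be empty, an instance could
   satisfy both the completeness and the soundness requirements. *)
Definition jc_promise (z y : nat) (g : nat -> nat) (I : jc_instance) : Prop :=
  [/\ uniq (jc_sets I),
      {in jc_sets I, forall T : {set 'I_(jc_univ I)}, #|T| = z},
      0 < size (jc_sets I),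
      0 < jc_k I &
      g (jc_univ I) * (jc_k I * jc_univ I ^ (z - y - 1)) <= size (jc_sets I)].

Definition jc_complete (y : nat) (I : jc_instance) : Prop :=
  exists S : 'I_(jc_k I) -> {set 'I_(jc_univ I)},
    (forall i, #|S i| = y) /\
    {in jc_sets I, forall T : {set 'I_(jc_univ I)}, exists i, S i \subset T}.

Definition jc_sound (R : realType) (alpha : R) (y : nat) (I : jc_instance)
    : Prop :=
  forall S : 'I_(jc_k I) -> {set 'I_(jc_univ I)},
    (forall i, #|S i| = y) ->
    ((count (fun T : {set 'I_(jc_univ I)} => [exists i, S i \subset T])
            (jc_sets I))%:R <= alpha * (size (jc_sets I))%:R)%R.

Definition johnson_coverage_star_NP_hard (R : realType) (alpha : R) (z y : nat)
    : Prop :=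
  exists g : nat -> nat,
    tends_to_infinity g /\
    NP_hard enc_jc
      (fun I => jc_promise z y g I /\ jc_complete y I)
      (fun I => jc_promise z y g I /\ jc_sound alpha y I).

Record hamming_instance := HammingInstance {
  hm_dim : nat;
  hm_points : seq (hm_dim.-tuple bool);
  hm_k : nat
}.

Definition enc_hamming (I : hamming_instance) : tree :=
  Node (enc_seq (fun a : (hm_dim I).-tuple bool => enc_bits a) (hm_points I))
       (enc_nat (hm_k I)).

Definition hamming_dist (d : nat) (a b : d.-tuple bool) : nat :=
  #|[set i : 'I_d | tnth a i != tnth b i]|.

(* [1 < size _] makes n log n positive: a one-point instance would satisfy both
   the completeness and the soundness requirements. *)
Definition hamming_promise (R : realType) (b : R) (I : hamming_instance)
    : Prop :=
  [/\ uniq (hm_points I),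
      1 < size (hm_points I),
      0 < hm_k I &
      ((hm_dim I)%:R <= b * ln ((size (hm_points I))%:R : R))%R].

Definition n_log_n (R : realType) (I : hamming_instance) : R :=
  ((size (hm_points I))%:R * ln ((size (hm_points I))%:R : R))%R.

(* The centers c_1, ..., c_k are not required to be distinct. *)
Definition assignment (I : hamming_instance)
    (c : 'I_(hm_k I) -> (hm_dim I).-tuple bool)
    (sigma : (hm_dim I).-tuple bool -> (hm_dim I).-tuple bool) : Prop :=
  {in hm_points I, forall a, exists i, sigma a = c i}.

Definition assignment_cost (I : hamming_instance)
    (sigma : (hm_dim I).-tuple bool -> (hm_dim I).-tuple bool) : nat :=
  \sum_(a <- hm_points I) hamming_dist a (sigma a).

Definition hamming_cost_at_most (R : realType) (v : R) (I : hamming_instance)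
    : Prop :=
  exists (c : 'I_(hm_k I) -> (hm_dim I).-tuple bool)
         (sigma : (hm_dim I).-tuple bool -> (hm_dim I).-tuple bool),
    assignment c sigma /\ ((assignment_cost sigma)%:R <= v)%R.

Definition hamming_cost_at_least (R : realType) (v : R) (I : hamming_instance)
    : Prop :=
  forall (c : 'I_(hm_k I) -> (hm_dim I).-tuple bool)
         (sigma : (hm_dim I).-tuple bool -> (hm_dim I).-tuple bool),
    assignment c sigma -> (v <= (assignment_cost sigma)%:R)%R.

(* Main.v *)
(* Johnson coverage is embedded into the Hamming cube through a code.  Every
   element i of the universe that occurs in E gets a word w_i in {0,1}^d, a
   concatenation of m = c * log |E| one-hot blocks, such that two words share
   less than log |E| of their m ones; a greedy Gilbert-Varshamov choice finds
   such words in polynomial time because the number of all words is polynomial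
   in |E|.  A set T becomes the union P_T of the w_i, i in T.  If a y-set S is
   contained in T then P_S is at distance at most (z - y) m from P_T, which
   gives completeness.  Conversely, let C be any centre.  Since the w_i are
   almost disjoint, only boundedly many elements are heavy, that is, have a
   constant fraction of w_i inside C.  Sets T with more than y heavy elements
   number O(|U|^(z-y-1)) per centre, hence o(|E|) in total; all other sets are,
   up to lower order terms, at distance at least (z - y + 1) m from C, except
   those containing one particular y-set, namely the y heaviest elements, which
   are at distance at least (z - y) m.  Soundness of the coverage instance bounds
   the number of the latter by alpha |E|.  The o(|E|) bound is of no use for
   small universes; those instances are answered by a finite table. *)

Require Import Defs.
From HB Require Import structures.
From mathcomp Require Import all_boot all_order all_algebra.
From mathcomp Require Import boolp reals exp.
From mathcomp Require Import zify ring lra.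

Set Implicit Arguments.
Unset Strict Implicit.
Unset Printing Implicit Defensive.

Import Order.TTheory GRing.Theory Num.Theory.

(* [tuple.v] also exports a [tsize]. *)
Local Notation tsize := Defs.tsize.

(** * Polynomial time in the WHILE language *)

(** A centre may be any point of the cube, so its distance to a union of words is controlled only
    through its shares |w_i ∩ C|. These add up to at most |C| plus the overlaps of the words, so the
    overlaps must be negligible against m. This fixes the order of the constants: W exceeds 4 / eps,
    K = 4 z W, the weight factor c is a multiple of K, and the alphabet size q is exponential in z
    and c, so that words with many agreements are rare enough for the greedy choice. None of them
    depends on the instance, hence the dimension q c log |E| is O(log n). A quarter of eps pays for
    the overlaps, a quarter for the sets with too many heavy elements, and the rest for rounding log
    |E| to an integer. The value of rho is the cost of the complete case divided by n ln n, up to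
    this rounding. Small universes still allow infinitely many values of k; beyond 2^N every
    instance is complete, so a finite table suffices. Polynomial time is established by closure
    properties of [computes], from which the program of the reduction is assembled. *)

Lemma tsize_gt0 t : 0 < tsize t.
Proof. by case: t. Qed.

Lemma tsize_tleft t : tsize (tleft t) <= tsize t.
Proof. by case: t => //= l r; lia. Qed.

Lemma tsize_tright t : tsize (tright t) <= tsize t.
Proof. by case: t => //= l r; lia. Qed.

(* An assignment costs the size of the stored value, so time bounds size. *)
Lemma exec_size s c s' t : exec s c s' t ->
  forall j, tsize (s' j) <= tsize (s j) + t.
Proof.
elim=> {s c s' t}.
- by move=> s j; lia.
- move=> s x e j; rewrite /update; case: eqP => _; lia.
- by move=> s1 s2 s3 c1 c2 t1 t2 _ IH1 _ IH2 j; move: (IH1 j) (IH2 j); lia.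
- by move=> s s' x c1 c2 t _ _ IH j; move: (IH j); lia.
- by move=> s s' x c1 c2 t _ _ IH j; move: (IH j); lia.
- by move=> s x c _ j; lia.
- by move=> s1 s2 s3 x c t1 t2 _ _ IH1 _ IH2 j; move: (IH1 j) (IH2 j); lia.
Qed.

Lemma leq_exp2rW m n e : m <= n -> m ^ e <= n ^ e.
Proof. by case: e => // e; rewrite leq_exp2r. Qed.

(** * Polynomial bounds *)

Definition poly_bounded (X : Type) (n f : X -> nat) : Prop :=
  exists p, forall x, f x <= p * n x ^ p.

Section PolyBounded.
Variables (X : Type) (n : X -> nat).
Implicit Types f g : X -> nat.

(** One constant serves as coefficient and exponent, as in [polytime]. The bound is then monotone in
    it even at base 0, because [p * 0 ^ p] vanishes for [p = 0] too. *)
Lemma leq_poly p q k : p <= q -> p * k ^ p <= q * k ^ q.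
Proof.
case: k => [|k] lepq; last by rewrite leq_mul // leq_pexp2l.
by case: p lepq => [|p] //; rewrite exp0n // muln0.
Qed.

Lemma poly_bounded_le f g : (forall x, f x <= g x) ->
  poly_bounded n g -> poly_bounded n f.
Proof. by move=> le_fg [p hp]; exists p => x; apply: leq_trans (hp x). Qed.

Lemma poly_bounded_id : poly_bounded n n.
Proof. by exists 1 => x; rewrite mul1n expn1. Qed.

Lemma poly_bounded_cst k : (forall x, 0 < n x) -> poly_bounded n (fun=> k).
Proof. by move=> n_gt0; exists k => x; rewrite leq_pmulr // expn_gt0 n_gt0. Qed.

Lemma poly_bounded_add f g : poly_bounded n f -> poly_bounded n g ->
  poly_bounded n (fun x => f x + g x).
Proof.
move=> [p hp] [q hq]; exists (p + q + (p + q)) => x; rewrite mulnDl.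
apply: leq_add; [apply: leq_trans (hp x) _ | apply: leq_trans (hq x) _].
  apply: leq_trans (leq_poly _ (leq_addr q p)) _.
  case: (n x) => [|k]; last by rewrite leq_mul // leq_pexp2l //; lia.
  by case: (p + q) => // r; rewrite exp0n // muln0.
apply: leq_trans (leq_poly _ (leq_addl p q)) _.
case: (n x) => [|k]; last by rewrite leq_mul // leq_pexp2l //; lia.
by case: (p + q) => // r; rewrite exp0n // muln0.
Qed.

Lemma poly_bounded_mul f g : poly_bounded n f -> poly_bounded n g ->
  poly_bounded n (fun x => f x * g x).
Proof.
move=> [p hp] [q hq]; exists (p * q + p + q) => x.
apply: leq_trans (leq_mul (hp x) (hq x)) _; rewrite mulnACA -expnD.
case: (n x) => [|k]; last by rewrite leq_mul // ?leq_pexp2l //; lia.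
case: p {hp} => [|p]; first by rewrite !mul0n.
by rewrite addSn exp0n // muln0.
Qed.

Lemma poly_bounded_trans (m : X -> nat) f :
  poly_bounded m f -> poly_bounded n m -> poly_bounded n f.
Proof.
move=> [p hp] [q hq]; exists (p * q ^ p + q * p) => x.
apply: leq_trans (hp x) _.
apply: (@leq_trans (p * (q * n x ^ q) ^ p)).
  by rewrite leq_mul // leq_exp2rW.
rewrite expnMn -expnM mulnA.
case: (n x) => [|k]; last by rewrite leq_mul // ?leq_pexp2l //; lia.
case: p {hp} => [|p]; first by rewrite !mul0n.
case: q {hq} => [|q]; first by rewrite exp0n // muln0.
by rewrite mulSn exp0n // muln0.
Qed.

Lemma poly_bounded_exp f k : (forall x, 0 < n x) -> poly_bounded n f ->
  poly_bounded n (fun x => f x ^ k).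
Proof.
move=> n_gt0 hf; elim: k => [|k IH]; first exact: poly_bounded_cst.
apply: (@poly_bounded_le _ (fun x => f x * f x ^ k)) => [x|].
  by rewrite expnS.
exact: poly_bounded_mul.
Qed.

End PolyBounded.

(* The expressions passed to [on_var] have a single, anonymous, input. *)
Fixpoint on_var (b : nat) (e : expr) : expr :=
  match e with
  | EVar _ => EVar b
  | ELeaf => ELeaf
  | ENode e1 e2 => ENode (on_var b e1) (on_var b e2)
  | ELeft e1 => ELeft (on_var b e1)
  | ERight e1 => ERight (on_var b e1)
  end.

Definition ev (e : expr) (t : tree) : tree := eval (fun=> t) e.

Lemma eval_on_var s b e : eval s (on_var b e) = ev e (s b).
Proof. by rewrite /ev; elim: e => //= [e1 -> e2 -> | e1 -> | e1 ->]. Qed.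

Fixpoint esize (e : expr) : nat :=
  match e with
  | EVar _ | ELeaf => 1
  | ENode e1 e2 => (esize e1 + esize e2).+1
  | ELeft e1 | ERight e1 => esize e1
  end.

Lemma tsize_ev e t : tsize (ev e t) <= esize e * tsize t.
Proof.
rewrite /ev; elim: e => /= [_||e1 IH1 e2 IH2|e IH|e IH].
- by rewrite mul1n.
- by rewrite mul1n tsize_gt0.
- by move: (tsize_gt0 t); rewrite mulSn mulnDl; lia.
- exact: leq_trans (tsize_tleft _) IH.
- exact: leq_trans (tsize_tright _) IH.
Qed.

(* The program [C b] reads its input and leaves its output in variable [b],
   overwrites only variables from [b] on, and assumes nothing about the
   variables above [b]. *)
Definition computes (X : Type) (u v : X -> tree) : Prop :=
  exists (C : nat -> cmd) (p : nat), forall b x (s : store), s b = u x ->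
    exists (s' : store) t,
      [/\ exec s (C b) s' t, s' b = v x, (forall j, j < b -> s' j = s j) &
          t <= p * tsize (u x) ^ p].

Local Notation size_bounded u f := (poly_bounded (fun x => tsize (u x)) f).

Lemma update_eq s x t : update s x t x = t.
Proof. by rewrite /update eqxx. Qed.

Lemma update_neq s x t y : y != x -> update s x t y = s y.
Proof. by rewrite /update => /negbTE ->. Qed.

Section Combinators.
Variable X : Type.
Implicit Types u v w : X -> tree.

Lemma size_bounded_cst u k : size_bounded u (fun=> k).
Proof. by apply: poly_bounded_cst => x; apply: tsize_gt0. Qed.

(** The output sits in the final store, whose growth is bounded by the running time. This is what
    makes time bounds compose. *)
Lemma computes_size u v : computes u v -> size_bounded u (fun x => tsize (v x)).
Proof.
move=> [C [p hC]].
apply: (@poly_bounded_le _ _ _ (fun x => tsize (u x) + p * tsize (u x) ^ p)).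
  move=> x; have [s' [t [hex <- _ ht]]] := hC 0 x (fun=> u x) erefl.
  by apply: leq_trans (exec_size hex 0) _; rewrite leq_add2l.
by apply: poly_bounded_add; [apply: poly_bounded_id | exists p].
Qed.

Lemma computes_ext u v v' : v =1 v' -> computes u v -> computes u v'.
Proof. by move=> e [C [p h]]; exists C, p => b x s; rewrite -e; apply: h. Qed.

Lemma computes_ev e u v : (forall x, ev e (u x) = v x) -> computes u v.
Proof.
move=> he; exists (fun b => Assign b (on_var b e)), (esize e).+1 => b x s hs.
exists (update s b (v x)), (tsize (v x)); split.
- by rewrite -he -hs -eval_on_var; constructor.
- by rewrite update_eq.
- by move=> j ltjb; rewrite update_neq // neq_ltn ltjb.
rewrite -he; apply: leq_trans (tsize_ev e _) _.
apply: leq_mul => //; rewrite -{1}[tsize _]expn1.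
by rewrite leq_pexp2l // tsize_gt0.
Qed.

Lemma computes_trans u v w : computes u v -> computes v w -> computes u w.
Proof.
move=> uv; have [p0 hp0] := computes_size uv.
case: uv => C1 [p1 h1] [C2 [p2 h2]].
have [p hp] : size_bounded u
    (fun x => p1 * tsize (u x) ^ p1 + p2 * tsize (v x) ^ p2).
  apply: poly_bounded_add; first by exists p1.
  by apply: (@poly_bounded_trans _ _ (fun x => tsize (v x))); [exists p2 | exists p0].
exists (fun b => Seq (C1 b) (C2 b)), p => b x s hs.
have [s1 [t1 [e1 v1 f1 b1]]] := h1 b x s hs.
have [s2 [t2 [e2 v2 f2 b2]]] := h2 b x s1 v1.
exists s2, (t1 + t2); split=> //.
- exact: ExecSeq e1 e2.
- by move=> j ltjb; rewrite f2 ?f1.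
- by apply: leq_trans (hp x); apply: leq_add.
Qed.

(** Each subprogram works on a copy of the input in a higher variable. As it leaves all lower
    variables alone, the input in [b] and the first result in [b.+1] survive. *)
Lemma computes_pair u v w : computes u v -> computes u w ->
  computes u (fun x => Node (v x) (w x)).
Proof.
move=> uv uw; have sv := computes_size uv; have sw := computes_size uw.
case: uv uw => C1 [p1 h1] [C2 [p2 h2]].
have [p hp] : size_bounded u (fun x => tsize (u x) + p1 * tsize (u x) ^ p1 +
    (tsize (u x) + p2 * tsize (u x) ^ p2) + (tsize (v x) + tsize (w x) + 1)).
  have su : size_bounded u (fun x => tsize (u x)) := poly_bounded_id _.
  have p1u : size_bounded u (fun x => p1 * tsize (u x) ^ p1) by exists p1.
  have p2u : size_bounded u (fun x => p2 * tsize (u x) ^ p2) by exists p2.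
  do ![exact: size_bounded_cst || exact: su || exact: p1u || exact: p2u ||
       exact: sv || exact: sw || apply: poly_bounded_add].
exists (fun b => Seq (Seq (Assign b.+1 (EVar b)) (C1 b.+1))
   (Seq (Seq (Assign b.+2 (EVar b)) (C2 b.+2))
        (Assign b (ENode (EVar b.+1) (EVar b.+2))))), p => b x s hs.
have [|s1 [t1 [e1 v1 f1 b1]]] := h1 b.+1 x (update s b.+1 (s b)).
  by rewrite update_eq.
have s1b : s1 b = u x by rewrite f1 // update_neq //; lia.
have [|s2 [t2 [e2 v2 f2 b2]]] := h2 b.+2 x (update s1 b.+2 (s1 b)).
  by rewrite update_eq.
have s2b : s2 b.+1 = v x by rewrite f2 // update_neq //; lia.
eexists; eexists; split.
- apply: ExecSeq; first by apply: ExecSeq e1; apply: ExecAssign.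
  apply: ExecSeq; first by apply: ExecSeq e2; apply: ExecAssign.
  exact: ExecAssign.
- by rewrite update_eq /= s2b v2.
- move=> j ltjb; rewrite update_neq ?f2 ?update_neq ?f1 ?update_neq //; lia.
- apply: leq_trans (hp x); rewrite /= s2b v2 s1b hs; lia.
Qed.

Lemma computes_if u c v w : computes u c -> computes u v -> computes u w ->
  computes u (fun x => if is_node (c x) then v x else w x).
Proof.
move=> [C0 [p0 h0]] [C1 [p1 h1]] [C2 [p2 h2]].
have [p hp] : size_bounded u (fun x => tsize (u x) + p0 * tsize (u x) ^ p0 +
    (p1 * tsize (u x) ^ p1 + p2 * tsize (u x) ^ p2 + 1)).
  do ![exact: size_bounded_cst || (by exists p0) || (by exists p1) ||
    (by exists p2) || exact: (poly_bounded_id (fun x => tsize (u x))) ||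
    apply: poly_bounded_add].
exists (fun b => Seq (Seq (Assign b.+1 (EVar b)) (C0 b.+1))
   (If b.+1 (C1 b) (C2 b))), p => b x s hs.
have [|s1 [t1 [e1 v1 f1 b1]]] := h0 b.+1 x (update s b.+1 (s b)).
  by rewrite update_eq.
have s1b : s1 b = u x by rewrite f1 // update_neq //; lia.
have ea : exec s (Assign b.+1 (EVar b)) (update s b.+1 (s b)) (tsize (s b)).
  exact: ExecAssign.
have hf j : j < b -> s1 j = s j.
  by move=> ltjb; rewrite f1 ?update_neq //; lia.
case: ifPn => hc.
  have [s2 [t2 [e2 v2 f2 b2]]] := h1 b x s1 s1b.
  exists s2; eexists; split.
  - apply: ExecSeq (ExecSeq ea e1) _.
    by apply: ExecIfTrue e2; rewrite v1.
  - by [].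
  - by move=> j ltjb; rewrite f2 ?hf.
  - apply: leq_trans (hp x); rewrite hs; lia.
have [s2 [t2 [e2 v2 f2 b2]]] := h2 b x s1 s1b.
exists s2; eexists; split.
- apply: ExecSeq (ExecSeq ea e1) _.
  by apply: ExecIfFalse e2; rewrite v1.
- by [].
- by move=> j ltjb; rewrite f2 ?hf.
- apply: leq_trans (hp x); rewrite hs; lia.
Qed.

Lemma computes_id u : computes u u.
Proof. exact: (@computes_ev (EVar 0)). Qed.

Lemma computes_const u t : computes u (fun=> t).
Proof.
have [e he] : exists e, forall t', ev e t' = t.
  elim: t => [|l [el hl] r [er hr]]; first by exists ELeaf.
  by exists (ENode el er) => t'; rewrite /ev /= -[eval _ el]/(ev el t')
    -[eval _ er]/(ev er t') hl hr.
by apply: (@computes_ev e) => x.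
Qed.

Lemma computes_left u v w :
  computes u (fun x => Node (v x) (w x)) -> computes u v.
Proof.
by move=> h; apply: computes_trans h _; apply: (@computes_ev (ELeft (EVar 0))).
Qed.

Lemma computes_right u v w :
  computes u (fun x => Node (v x) (w x)) -> computes u w.
Proof.
by move=> h; apply: computes_trans h _; apply: (@computes_ev (ERight (EVar 0))).
Qed.

End Combinators.

Lemma computes_reindex (X Y : Type) (h : Y -> X) (u v : X -> tree) :
  computes u v -> computes (fun y => u (h y)) (fun y => v (h y)).
Proof. by move=> [C [p hC]]; exists C, p => b y s; apply: hC. Qed.

(** * Folds over lists as loops *)

Lemma tsize_enc_seq_cons A (enc : A -> tree) a s :
  tsize (enc_seq enc (a :: s)) = (tsize (enc a) + tsize (enc_seq enc s)).+1.
Proof. by []. Qed.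

Section Fold.
Variables (X : Type) (Y : eqType) (Z : Type) (eY : Y -> tree) (eZ : Z -> tree).
Variables (u : X -> tree) (L : X -> seq Y) (z0 : X -> Z) (f : X -> Z -> Y -> Z).

Hypothesis uL : computes u (fun x => enc_seq eY (L x)).
Hypothesis uz : computes u (fun x => eZ (z0 x)).
Hypothesis uf : computes
  (fun p : X * Z * Y => Node (u p.1.1) (Node (eZ p.1.2) (eY p.2)))
  (fun p => eZ (f p.1.1 p.1.2 p.2)).

Let body (C : nat -> cmd) b :=
  Seq (Assign b.+3 (ENode (EVar b) (ENode (EVar b.+2) (ELeft (EVar b.+1)))))
  (Seq (C b.+3)
  (Seq (Assign b.+2 (EVar b.+3)) (Assign b.+1 (ERight (EVar b.+1))))).

(** Variable [b] holds the parameters, [b.+1] the rest of the list, [b.+2] the accumulator, and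
    [b.+3] is where the body runs. [D] bounds the size of the input of the body in every round. *)
Let loop C p b x ys z (s : store) (B N : nat) :
  (forall b x s, s b = Node (u x.1.1) (Node (eZ x.1.2) (eY x.2)) ->
    exists (s' : store) t,
      [/\ exec s (C b) s' t, s' b = eZ (f x.1.1 x.1.2 x.2),
          (forall j, j < b -> s' j = s j) &
          t <= p * tsize (Node (u x.1.1) (Node (eZ x.1.2) (eY x.2))) ^ p]) ->
  (forall i, tsize (eZ (foldl (f x) z (take i ys))) <= B) ->
  tsize (enc_seq eY ys) <= N ->
  s b = u x -> s b.+1 = enc_seq eY ys -> s b.+2 = eZ z ->
  let D := tsize (u x) + B + N + 2 in
  exists (s' : store) t,
    [/\ exec s (While b.+1 (body C b)) s' t, s' b.+2 = eZ (foldl (f x) z ys),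
        (forall j, j < b -> s' j = s j) &
        t <= size ys * (p * D ^ p + D + B + N + 1) + 1].
Proof.
move=> hC; elim: ys z s => [|y ys IH] z s hB hN sb sb1 sb2 D.
  by exists s, 1; split=> //=; apply: ExecWhileFalse; rewrite sb1.
set s1 := update s b.+3 (Node (u x) (Node (eZ z) (eY y))).
have [|s2 [t2 [e2 v2 f2 b2]]] := hC b.+3 (x, z, y) s1; first by rewrite /s1 update_eq.
set s3 := update s2 b.+2 (s2 b.+3).
set s4 := update s3 b.+1 (tright (s3 b.+1)).
have s2b j : j < b.+3 -> s2 j = s j.
  by move=> ltj; rewrite f2 // /s1 update_neq //; lia.
have s3b1 : s3 b.+1 = Node (eY y) (enc_seq eY ys).
  by rewrite /s3 update_neq ?s2b ?sb1 //; lia.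
have hB1 := hB 1; have hB0 := hB 0; rewrite /= take0 /= in hB0 hB1.
rewrite tsize_enc_seq_cons in hN.
have [|||||s5 [t5 [e5 v5 f5 b5]]] := IH (f x z y) s4.
- by move=> i; apply: (hB i.+1).
- by lia.
- by rewrite /s4 /s3 !update_neq ?s2b //; lia.
- by rewrite /s4 update_eq s3b1.
- by rewrite /s4 update_neq ?/s3 ?update_eq ?v2 //; lia.
exists s5; eexists; split.
- apply: ExecWhileTrue e5; first by rewrite sb1.
  apply: ExecSeq; first exact: ExecAssign.
  rewrite /= sb sb1 sb2 /=; apply: ExecSeq; first exact: e2.
  by apply: ExecSeq; apply: ExecAssign.
- by [].
- by move=> j ltj; rewrite f5 ?/s4 ?/s3 ?update_neq ?s2b //; lia.
rewrite /= sb sb1 sb2 -/s3 s3b1 v2 /=.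
move: b2 b5 => /=; rewrite -/D => b2 b5.
have : p * (tsize (u x) + (tsize (eZ z) + tsize (eY y)).+1).+1 ^ p <= p * D ^ p.
  by rewrite leq_mul // leq_exp2rW // /D; lia.
rewrite mulSn; lia.
Qed.

(** Iterating a polynomial-time body may produce values of exponential size, hence the bound [B] on
    all intermediate accumulators. *)
Lemma computes_foldl (B : X -> nat) : size_bounded u B ->
  (forall x i, tsize (eZ (foldl (f x) (z0 x) (take i (L x)))) <= B x) ->
  computes u (fun x => eZ (foldl (f x) (z0 x) (L x))).
Proof.
move=> pB hB; have sL := computes_size uL; have sz := computes_size uz.
case: uL uz uf => CL [pL hL] [Cz [pz hz]] [C [p hC]].
pose N x := tsize (enc_seq eY (L x)); pose D x := tsize (u x) + B x + N x + 2.
have hN x : size (L x) <= N x.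
  by rewrite /N; elim: (L x) => //= y ys IH; lia.
have su : size_bounded u (fun x => tsize (u x)) := poly_bounded_id _.
have pD : size_bounded u D.
  by do ![exact: size_bounded_cst || exact: su || exact: sL || exact: pB ||
    apply: poly_bounded_add].
have [r hr] : size_bounded u (fun x =>
    (tsize (u x) + pL * tsize (u x) ^ pL) + (tsize (u x) + pz * tsize (u x) ^ pz)
    + (N x * (p * D x ^ p + D x + B x + N x + 1) + 1 + B x)).
  do ![exact: size_bounded_cst || exact: su || exact: sL || exact: pB ||
    exact: pD || (by exists pL) || (by exists pz) ||
    apply: poly_bounded_add || apply: poly_bounded_mul ||
    apply: poly_bounded_exp]; by move=> x; apply: tsize_gt0.
exists (fun b => Seq (Seq (Assign b.+1 (EVar b)) (CL b.+1))
   (Seq (Seq (Assign b.+2 (EVar b)) (Cz b.+2))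
   (Seq (While b.+1 (body C b)) (Assign b (EVar b.+2))))), r => b x s hs.
have [|s1 [t1 [e1 v1 f1 b1]]] := hL b.+1 x (update s b.+1 (s b)).
  by rewrite update_eq.
have s1b : s1 b = u x by rewrite f1 // update_neq //; lia.
have [|s2 [t2 [e2 v2 f2 b2]]] := hz b.+2 x (update s1 b.+2 (s1 b)).
  by rewrite update_eq.
have [|||s3 [t3 [e3 v3 f3 b3]]] :=
    loop (b := b) (x := x) (ys := L x) (z := z0 x) (s := s2) hC (hB x)
      (leqnn _).
- by rewrite f2 ?update_neq //; lia.
- by rewrite f2 ?update_neq //; lia.
- exact: v2.
exists (update s3 b (s3 b.+2)); eexists; split.
- apply: ExecSeq; first by apply: ExecSeq e1; apply: ExecAssign.
  apply: ExecSeq; first by apply: ExecSeq e2; apply: ExecAssign.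
  by apply: ExecSeq e3 _; apply: ExecAssign.
- by rewrite update_eq v3.
- by move=> j ltj; rewrite update_neq ?f3 ?f2 ?update_neq ?f1 ?update_neq //; lia.
apply: leq_trans (hr x); rewrite /= v3 s1b hs.
have := hB x (size (L x)); rewrite take_size.
have := leq_mul (hN x) (leqnn (p * D x ^ p + D x + B x + N x + 1)).
move: b3; rewrite -/(N x) -/(D x); lia.
Qed.

Lemma computes_foldl_add (B : X -> nat) : size_bounded u B ->
  (forall x y z, y \in L x ->
     tsize (eZ (f x z y)) <= tsize (eZ z) + B x) ->
  computes u (fun x => eZ (foldl (f x) (z0 x) (L x))).
Proof.
move=> pB hB; have sL := computes_size uL; have sz := computes_size uz.
pose N x := tsize (enc_seq eY (L x)).
have hN x : size (L x) <= N x.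
  by rewrite /N; elim: (L x) => //= y ys IH; lia.
apply: (@computes_foldl (fun x => tsize (eZ (z0 x)) + N x * B x)).
  by do ![exact: sz || exact: sL || exact: pB ||
    apply: poly_bounded_add || apply: poly_bounded_mul].
move=> x i; apply: (@leq_trans (tsize (eZ (z0 x)) + size (L x) * B x)); last first.
  by rewrite leq_add2l leq_mul.
elim: (L x) (z0 x) i (hB x) => [|y ys IH] z i hBx /=; first by lia.
case: i => [|i] /=; first by lia.
have h1 := hBx y z (mem_head _ _).
have h2 := IH (f x z y) i (fun y' z' h => hBx y' z' (mem_behead (s := y :: ys) h)).
by rewrite mulSn; lia.
Qed.

End Fold.

(** The body of a fold receives [Node u (Node z y)]: parameters, accumulator, current element. These
    paths select the components. *)
Local Notation V0 := (EVar 0).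
Local Notation VL := (ELeft V0).
Local Notation VR := (ERight V0).
Local Notation VRL := (ELeft (ERight V0)).
Local Notation VRR := (ERight (ERight V0)).

(** * Iteration and unary arithmetic *)

Section Basic.
Variable X : Type.
Implicit Types u v w : X -> tree.

Lemma computes_wk (Y : Type) (h : Y -> X) u v (r : Y -> tree) : computes u v ->
  computes (fun y => Node (u (h y)) (r y)) (fun y => v (h y)).
Proof.
move=> uv; apply: computes_trans (computes_reindex h uv).
exact: (@computes_ev _ VL).
Qed.

(** A unary number has the encoding of a list of units, so iteration is a fold over [nseq n tt]. *)
Lemma computes_iter (Z : Type) (eZ : Z -> tree) u (n : X -> nat) z0
    (f : X -> Z -> Z) (B : X -> nat) :
  computes u (fun x => enc_nat (n x)) -> computes u (fun x => eZ (z0 x)) ->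
  computes (fun p : X * Z => Node (u p.1) (eZ p.2)) (fun p => eZ (f p.1 p.2)) ->
  size_bounded u B ->
  (forall x i, i <= n x -> tsize (eZ (iter i (f x) (z0 x))) <= B x) ->
  computes u (fun x => eZ (iter (n x) (f x) (z0 x))).
Proof.
move=> un uz uf pB hB.
have it x (i : nat) z : foldl (fun z _ => f x z) z (nseq i tt) = iter i (f x) z.
  by elim: i z => // i IH z; rewrite /= IH -iterSr.
apply: (@computes_ext _ _
    (fun x => eZ (foldl (fun z _ => f x z) (z0 x) (nseq (n x) tt)))) => [x|].
  by rewrite it.
apply: (@computes_foldl _ _ _ (fun=> Leaf) eZ _ _ _ (fun x z _ => f x z)
          _ uz _ B pB).
- by apply: computes_ext un => x; elim: (n x) => //= k ->.
- apply: (@computes_trans _ _ (fun p : X * Z * unit => Node (u p.1.1) (eZ p.1.2))).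
    exact: (@computes_ev _ (ENode VL VRL)).
  exact: (computes_reindex (fun p : X * Z * unit => p.1) uf).
- move=> x i; have -> : take i (nseq (n x) tt) = nseq (minn i (n x)) tt.
    by elim: (n x) i => [|k IH] [|i] //=; rewrite ?IH ?minn0 ?minnSS.
  by rewrite it; apply: hB; rewrite geq_minr.
Qed.

Lemma computes_iter_add (Z : Type) (eZ : Z -> tree) u (n : X -> nat) z0
    (f : X -> Z -> Z) (B : X -> nat) :
  computes u (fun x => enc_nat (n x)) -> computes u (fun x => eZ (z0 x)) ->
  computes (fun p : X * Z => Node (u p.1) (eZ p.2)) (fun p => eZ (f p.1 p.2)) ->
  size_bounded u B ->
  (forall x z, tsize (eZ (f x z)) <= tsize (eZ z) + B x) ->
  computes u (fun x => eZ (iter (n x) (f x) (z0 x))).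
Proof.
move=> un uz uf pB hB; have sn := computes_size un; have sz := computes_size uz.
apply: (@computes_iter _ _ _ _ _ _
   (fun x => tsize (eZ (z0 x)) + tsize (enc_nat (n x)) * B x)) => //.
  by do ![exact: sz || exact: sn || exact: pB ||
    apply: poly_bounded_add || apply: poly_bounded_mul].
move=> x i le_i; apply: (@leq_trans (tsize (eZ (z0 x)) + i * B x)).
  elim: i {le_i} => [|i IH] /=; first by rewrite addn0.
  by rewrite mulSn; move: (hB x (iter i (f x) (z0 x))); lia.
rewrite leq_add2l leq_mul //; apply: leq_trans le_i _.
by elim: (n x) => //= k; lia.
Qed.

Lemma tsize_enc_nat n : tsize (enc_nat n) = n.*2.+1.
Proof. by elim: n => //= n ->; lia. Qed.

Lemma enc_nat_pred n : enc_nat n.-1 = tright (enc_nat n).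
Proof. by case: n. Qed.

Lemma is_node_enc_nat n : is_node (enc_nat n) = (0 < n).
Proof. by case: n. Qed.

Lemma is_node_enc_bool b : is_node (enc_bool b) = b.
Proof. by case: b. Qed.

Lemma computes_subn u m n :
  computes u (fun x => enc_nat (m x)) -> computes u (fun x => enc_nat (n x)) ->
  computes u (fun x => enc_nat (m x - n x)).
Proof.
move=> um un; apply: (@computes_ext _ _ (fun x => enc_nat (iter (n x) predn (m x)))).
  by move=> x; congr enc_nat; elim: (n x) => [|k /= ->] //=; lia.
apply: (@computes_iter_add _ enc_nat _ n m (fun=> predn) (fun=> 0)) => //.
- by apply: (@computes_ev _ (ERight VR)) => -[x k]; rewrite enc_nat_pred.
- exact: size_bounded_cst.
- by move=> x k; rewrite !tsize_enc_nat; lia.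
Qed.

Lemma computes_eqn u m n :
  computes u (fun x => enc_nat (m x)) -> computes u (fun x => enc_nat (n x)) ->
  computes u (fun x => enc_bool (m x == n x)).
Proof.
move=> um un; have mn := computes_subn um un; have nm := computes_subn un um.
have uT t := computes_const u t.
apply: computes_ext (computes_if mn (uT Leaf)
  (computes_if nm (uT Leaf) (uT (Node Leaf Leaf)))) => x /=.
rewrite !is_node_enc_nat; case: ifP => // h1; last case: ifP => // h2.
all: by rewrite /enc_bool; case: eqP => //; lia.
Qed.

Lemma computes_if_bool u c v w : computes u (fun x => enc_bool (c x)) ->
  computes u v -> computes u w -> computes u (fun x => if c x then v x else w x).
Proof.
move=> uc uv uw; apply: computes_ext (computes_if uc uv uw) => x.
by rewrite is_node_enc_bool.
Qed.

End Basic.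

(** * Encoded lists *)

Lemma tsize_enc_seq_mem (Y : eqType) (eY : Y -> tree) y (s : seq Y) :
  y \in s -> tsize (eY y) < tsize (enc_seq eY s).
Proof.
elim: s => //= z s IH; rewrite inE => /predU1P[<-|/IH]; lia.
Qed.

Lemma tsize_enc_seq_cat (Y : Type) (eY : Y -> tree) (s t : seq Y) :
  (tsize (enc_seq eY (s ++ t))).+1 = tsize (enc_seq eY s) + tsize (enc_seq eY t).
Proof. elim: s => //= y s IH; lia. Qed.

Lemma size_enc_seq (Y : Type) (eY : Y -> tree) (s : seq Y) :
  size s < tsize (enc_seq eY s).
Proof. by elim: s => //= y s IH; lia. Qed.

Lemma tsize_enc_bool b : tsize (enc_bool b) <= 3.
Proof. by case: b. Qed.

Lemma tsize_enc_bits w : tsize (enc_bits w) <= 4 * size w + 1.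
Proof. by elim: w => //= b w IH; move: (tsize_enc_bool b); lia. Qed.

Section Lists.
Variables (X : Type) (Y : eqType) (eY : Y -> tree).
Implicit Types (u : X -> tree) (L : X -> seq Y).

Lemma computes_size_seq u L : computes u (fun x => enc_seq eY (L x)) ->
  computes u (fun x => enc_nat (size (L x))).
Proof.
move=> uL; apply: (@computes_ext _ _
  (fun x => enc_nat (foldl (fun k _ => k.+1) 0 (L x)))) => [x|].
  congr enc_nat; rewrite -[RHS]addn0; move: 0 => k.
  by elim: (L x) k => //= y s IH k; rewrite IH; lia.
apply: (@computes_foldl_add _ _ _ eY enc_nat _ _ _ (fun _ k _ => k.+1) uL _ _
  (fun=> 2)).
- exact: computes_const.
- exact: (@computes_ev _ (ENode ELeaf VRL)).
- exact: size_bounded_cst.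
- by move=> x y k _; rewrite !tsize_enc_nat; lia.
Qed.

Lemma computes_catrev u L L' : computes u (fun x => enc_seq eY (L x)) ->
  computes u (fun x => enc_seq eY (L' x)) ->
  computes u (fun x => enc_seq eY (catrev (L x) (L' x))).
Proof.
move=> uL uL'; apply: (@computes_ext _ _
  (fun x => enc_seq eY (foldl (fun s y => y :: s) (L' x) (L x)))) => [x|].
  by congr enc_seq; elim: (L x) (L' x) => //= y s IH s'; rewrite IH.
apply: (@computes_foldl_add _ _ _ eY (enc_seq eY) _ _ _ (fun _ s y => y :: s)
  uL uL' _ (fun x => tsize (enc_seq eY (L x)))).
- exact: (@computes_ev _ (ENode VRR VRL)).
- exact: computes_size uL.
- by move=> x y s /(tsize_enc_seq_mem eY) /=; lia.
Qed.

Lemma computes_rev u L : computes u (fun x => enc_seq eY (L x)) ->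
  computes u (fun x => enc_seq eY (rev (L x))).
Proof. by move=> uL; apply: (computes_catrev (L' := fun=> [::]) uL); apply:
  computes_const. Qed.

(** Accumulating by cons reverses the list. The reversal is kept, since the order of the points is
    immaterial. *)
Lemma computes_map (V : eqType) (eV : V -> tree) u L (f : X -> Y -> V) :
  computes u (fun x => enc_seq eY (L x)) ->
  computes (fun p : X * Y => Node (u p.1) (eY p.2)) (fun p => eV (f p.1 p.2)) ->
  computes u (fun x => enc_seq eV (rev [seq f x y | y <- L x])).
Proof.
move=> uL uf; have [p hp] := computes_size uf.
pose B x := p * (tsize (u x) + tsize (enc_seq eY (L x))) ^ p + 1.
apply: (@computes_ext _ _
    (fun x => enc_seq eV (foldl (fun s y => f x y :: s) [::] (L x)))) => [x|].
  rewrite /rev; congr enc_seq; move: [::] => s.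
  by elim: (L x) s => //= y s' IH s; rewrite IH.
have sL := computes_size uL; have su : size_bounded u (fun x => tsize (u x)) :=
  poly_bounded_id _.
apply: (@computes_foldl_add _ _ _ eY (enc_seq eV) _ _ _
  (fun x s y => f x y :: s) uL _ _ B).
- exact: computes_const.
- apply: (@computes_trans _ _ (fun r : X * seq V * Y => Node (eV (f r.1.1 r.2))
  (enc_seq eV r.1.2))).
    apply: computes_pair; last exact: (@computes_ev _ VRL).
    apply: computes_trans (computes_reindex (fun r : X * seq V * Y => (r.1.1, r.2)) uf).
    exact: (@computes_ev _ (ENode VL VRR)).
  exact: (@computes_ev _ V0).
- rewrite /B; do ![exact: su || exact: sL || exact: size_bounded_cst ||
    apply: poly_bounded_add || apply: poly_bounded_mul || apply: poly_bounded_exp].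
  by move=> x; apply: tsize_gt0.
- move=> x y s /(tsize_enc_seq_mem eY) hy; have := hp (x, y) => /= h.
  have : p * (tsize (u x) + tsize (eY y)).+1 ^ p + 1 <= B x.
    rewrite /B leq_add2r leq_mul // leq_exp2rW //; lia.
  lia.
Qed.

End Lists.

(** * The greedy code *)

(* [(a, b, l)] after [t] steps from [(1, 0, 0)] satisfies
   [t + 1 + a = 2 ^ l.+1 = 2 * a + b], hence [2 ^ l <= t + 1 <= 2 ^ l.+1]. *)
Definition log_step (s : nat * nat * nat) : nat * nat * nat :=
  let: (a, b, l) := s in
  if 0 < a then (a.-1, b.+2, l) else (b.-1, 2, l.+1).

Definition rlog (n : nat) : nat := (iter n.-1 log_step (1, 0, 0)).2.

Lemma rlogP n : 0 < n -> 2 ^ rlog n <= n <= 2 ^ (rlog n).+1.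
Proof.
rewrite /rlog; case: n => //= n _.
suff: let: (a, b, l) := iter n log_step (1, 0, 0) in
    (n + 1 + a == 2 ^ l.+1) && (2 * a + b == 2 ^ l.+1).
  case: (iter _ _ _) => [[a b] l] /= /andP[/eqP h1 /eqP h2].
  by rewrite expnS in h1 h2 *; lia.
elim: n => //= n; case: (iter _ _ _) => [[[|a] b] l] /= /andP[/eqP h1 /eqP h2].
  by rewrite !expnS in h1 h2 *; lia.
by apply/andP; split; apply/eqP; lia.
Qed.

Definition enc_log (s : nat * nat * nat) : tree :=
  Node (Node (enc_nat s.1.1) (enc_nat s.1.2)) (enc_nat s.2).

Lemma computes_rlog X (u : X -> tree) n : computes u (fun x => enc_nat (n x)) ->
  computes u (fun x => enc_nat (rlog (n x))).
Proof.
move=> un; apply: (@computes_right _ _ (fun x => Node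
   (enc_nat (iter (n x).-1 log_step (1, 0, 0)).1.1)
   (enc_nat (iter (n x).-1 log_step (1, 0, 0)).1.2))).
apply: (@computes_iter_add _ _ enc_log _ (fun x => (n x).-1) (fun=> (1, 0, 0))
   (fun=> log_step) (fun=> 8)).
- apply: computes_trans un _; apply: (@computes_ev _ VR) => x.
  by rewrite enc_nat_pred.
- exact: computes_const.
- apply: computes_ext (@computes_if _ _ (fun p => enc_nat p.2.1.1)
     (fun p => enc_log (p.2.1.1.-1, p.2.1.2.+2, p.2.2))
     (fun p => enc_log (p.2.1.2.-1, 2, p.2.2.+1)) _ _ _).
  + by move=> [x [[a b] l]] /=; rewrite is_node_enc_nat; case: ltnP.
  + exact: (@computes_ev _ (ELeft (ELeft VR))).
  + apply: (@computes_ev _ (ENode (ENode (ERight (ELeft (ELeft VR)))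
      (ENode ELeaf (ENode ELeaf (ERight (ELeft VR))))) (ERight VR))).
    by move=> [x [[a b] l]]; rewrite /enc_log enc_nat_pred.
  + apply: (@computes_ev _ (ENode (ENode (ERight (ERight (ELeft VR)))
      (ENode ELeaf (ENode ELeaf ELeaf))) (ENode ELeaf (ERight VR)))).
    by move=> [x [[a b] l]]; rewrite /enc_log enc_nat_pred.
- exact: size_bounded_cst.
- move=> x [[a b] l]; rewrite /enc_log /log_step; case: ltnP => ha /=;
    rewrite !tsize_enc_nat; lia.
Qed.

Lemma computes_muln_cst X (u : X -> tree) c n :
  computes u (fun x => enc_nat (n x)) -> computes u (fun x => enc_nat (c * n x)).
Proof.
move=> un; apply: (@computes_ext _ _ (fun x => enc_nat (iter (n x) (addn c) 0))).
  by move=> x; rewrite iter_addn_0.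
apply: (@computes_iter_add _ _ enc_nat _ n (fun=> 0) (fun=> addn c)
  (fun=> c.*2)) => //.
- exact: computes_const.
- apply: (@computes_ev _ (iter c (ENode ELeaf) VR)) => -[x k] /=.
  by elim: c => //= c <-.
- exact: size_bounded_cst.
- by move=> x k; rewrite !tsize_enc_nat; lia.
Qed.

(** * Words made of one-hot blocks *)

Definition one_hot (q i : nat) : seq bool := [seq j == i | j <- iota 0 q].
Definition one_hots (q : nat) : seq (seq bool) := [seq one_hot q i | i <- iota 0 q].

Definition extend_words (ss : seq (seq bool)) (W : seq (seq bool)) :=
  foldl (fun R w => [seq s ++ w | s <- ss] ++ R) [::] W.

Definition words (q m : nat) : seq (seq bool) :=
  iter m (extend_words (one_hots q)) [:: [::]].

Lemma extend_wordsE ss W : extend_words ss W =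
  flatten [seq [seq s ++ w | s <- ss] | w <- rev W].
Proof.
rewrite /extend_words.
suff H R : foldl (fun R w => [seq s ++ w | s <- ss] ++ R) R W
    = flatten [seq [seq s ++ w | s <- ss] | w <- rev W] ++ R by rewrite H cats0.
elim: W R => //= w W IH R.
by rewrite IH rev_cons map_rcons flatten_rcons catA.
Qed.

Lemma mem_extend_words ss W v :
  reflect (exists2 w, w \in W & exists2 s, s \in ss & v = s ++ w)
          (v \in extend_words ss W).
Proof.
rewrite extend_wordsE; apply: (iffP flatten_mapP) => -[w hw].
  by case/mapP=> s hs ->; exists w; [rewrite -mem_rev | exists s].
by case=> s hs ->; exists w; [rewrite mem_rev | apply: map_f].
Qed.

Lemma sum_extend_words (F : seq bool -> nat) ss W :
  \sum_(v <- extend_words ss W) F v = \sum_(w <- W) \sum_(s <- ss) F (s ++ w).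
Proof.
rewrite extend_wordsE big_flatten big_map /= (perm_big _ (permEl (perm_rev W))).
by apply: eq_bigr => w _; rewrite big_map.
Qed.

Local Notation enc_words := (enc_seq enc_bits).

Lemma tsize_cat_prefixes ss w R :
  tsize (enc_words ([seq s ++ w | s <- ss] ++ R)) <=
  tsize (enc_words R) + (tsize (enc_words ss) + size ss * tsize (enc_bits w)).
Proof.
elim: ss => [|s ss IH] /=; first by lia.
move: (tsize_enc_seq_cat enc_bool s w) IH; rewrite mulSn /enc_bits; lia.
Qed.

(** The list [ss] is fixed, so prepending all its members to a word is a single expression of the
    language. *)
Lemma computes_extend_words X (u : X -> tree) ss W :
  computes u (fun x => enc_words (W x)) ->
  computes u (fun x => enc_words (extend_words ss (W x))).
Proof.
move=> uW; apply: (@computes_foldl_add _ _ _ enc_bits enc_words _ _ _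
   (fun _ R w => [seq s ++ w | s <- ss] ++ R) uW _ _
   (fun x => tsize (enc_words ss) + size ss * tsize (enc_words (W x)))).
- exact: computes_const.
- have [e he] : exists e, forall t R w,
      ev e (Node t (Node (enc_words R) (enc_bits w)))
      = enc_words ([seq s ++ w | s <- ss] ++ R).
    elim: ss => [|s ss [e he]] /=; first by exists VRL.
    have [e' he'] : exists e', forall t R w,
        ev e' (Node t (Node (enc_words R) (enc_bits w))) = enc_bits (s ++ w).
      elim: s => [|b s [e' he']] /=; first by exists VRR.
      exists (ENode (if b then ENode ELeaf ELeaf else ELeaf) e') => t R w.
      by rewrite /ev /= -/(ev e' _) he'; case: b.
    by exists (ENode e' e) => t R w; rewrite /ev /= -/(ev e' _) -/(ev e _) he he'.
  by apply: (@computes_ev _ e) => -[[x R] w].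
- have sW := computes_size uW.
  by do ![exact: sW || exact: size_bounded_cst || apply: poly_bounded_add ||
    apply: poly_bounded_mul].
move=> x w R /(tsize_enc_seq_mem enc_bits) /ltnW hw.
apply: leq_trans (tsize_cat_prefixes _ _ _) _.
by rewrite !leq_add2l leq_mul2l hw orbT.
Qed.

Lemma size_words q m w : w \in words q m -> size w = m * q.
Proof.
elim: m w => [|m IH] w; first by rewrite inE => /eqP ->.
case/mem_extend_words => v /IH hv [s /mapP[i _ ->] ->].
by rewrite size_cat hv mulSn size_map size_iota.
Qed.

Lemma card_words q m : size (words q m) = q ^ m.
Proof.
elim: m => //= m IH; rewrite -sum1_size sum_extend_words.
under eq_bigr do rewrite sum1_size size_map size_iota.
by rewrite big_const_seq count_predT iter_addn_0 IH expnS.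
Qed.

Lemma computes_words X (u : X -> tree) q m : 0 < q ->
  computes u (fun x => enc_nat (m x)) -> size_bounded u (fun x => q ^ m x) ->
  computes u (fun x => enc_words (words q (m x))).
Proof.
move=> q_gt0 um pq.
apply: (@computes_iter _ _ enc_words _ m (fun=> [:: [::]])
  (fun=> extend_words (one_hots q))
  (fun x => q ^ m x * (4 * (tsize (enc_nat (m x)) * q) + 2) + 1)) => //.
- exact: computes_const.
- by apply: computes_extend_words; apply: (@computes_ev _ VR).
- have sm := computes_size um.
  by do ![exact: sm || exact: pq || exact: size_bounded_cst ||
    apply: poly_bounded_add || apply: poly_bounded_mul].
move=> x i le_i; rewrite -/(words q i).
apply: (@leq_trans (size (words q i) * (4 * (i * q) + 2) + 1)); last first.
  rewrite leq_add2r card_words leq_mul ?leq_pexp2l // leq_add2r leq_mul2l /=.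
  by rewrite leq_mul2r; apply/orP; right; apply: leq_trans le_i _;
    rewrite tsize_enc_nat; lia.
have : {in words q i, forall w, size w <= i * q}.
  by move=> w /size_words ->.
elim: (words q i) => //= w W IH hW.
have {}IH := IH (fun w' h => hW w' (mem_behead (s := w :: W) h)).
have := tsize_enc_bits w; have := hW w (mem_head _ _).
rewrite mulSn; lia.
Qed.

Definition agree (v w : seq bool) : nat := count (fun p => p.1 && p.2) (zip v w).

(** The fold runs along one word and consumes the other in its state. Counting down from [l] turns
    the test [agree v w < l] into the test that a unary number is nonzero. *)
Definition agree_step (s : seq bool * nat) (b : bool) : seq bool * nat :=
  (behead s.1, if b then if head false s.1 then s.2.-1 else s.2 else s.2).

Lemma foldl_agree v w l : (foldl agree_step (w, l) v).2 = l - agree v w.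
Proof.
rewrite /agree; elim: v w l => [|b v IH] [|b' w] l /=; rewrite ?subn0 ?IH //.
  have -> : zip v ([::] : seq bool) = [::] by case: (v).
  by case: b => /=; rewrite subn0.
by case: b; case: b' => //=; lia.
Qed.

Lemma computes_agree_lt X (u : X -> tree) v w l :
  computes u (fun x => enc_bits (v x)) -> computes u (fun x => enc_bits (w x)) ->
  computes u (fun x => enc_nat (l x)) ->
  computes u (fun x => enc_nat (l x - agree (v x) (w x))).
Proof.
move=> uv uw ul.
pose e (s : seq bool * nat) := Node (enc_bits s.1) (enc_nat s.2).
apply: (@computes_right _ _
   (fun x => enc_bits (foldl agree_step (w x, l x) (v x)).1)).
apply: (@computes_ext _ _ (fun x => e (foldl agree_step (w x, l x) (v x)))).
  by move=> x; rewrite /e foldl_agree.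
apply: (@computes_foldl_add _ _ _ enc_bool e _ _ _ (fun=> agree_step) uv _ _ (fun=> 0)).
- exact: computes_pair uw ul.
- apply: computes_pair.
    apply: (@computes_ev _ (ERight (ELeft VRL))) => -[[x [s k]] b] /=.
    by rewrite /ev /=; case: s.
  have hk : computes (fun p : X * (seq bool * nat) * bool =>
      Node (u p.1.1) (Node (e p.1.2) (enc_bool p.2))) (fun p => enc_nat p.1.2.2).
    exact: (@computes_ev _ (ERight VRL)).
  apply: (@computes_ext _ _ (fun p => if p.2 then
      if head false p.1.2.1 then enc_nat p.1.2.2.-1 else enc_nat p.1.2.2
      else enc_nat p.1.2.2)).
    by move=> p; rewrite /agree_step /=; case: p.2 => //; case: head.
  apply: computes_if_bool (hk); first exact: (@computes_ev _ VRR).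
  apply: computes_if_bool (hk).
    by apply: (@computes_ev _ (ELeft (ELeft VRL))) => -[[x [[|? ?] k]] b].
  by apply: computes_trans hk _; apply: (@computes_ev _ VR) => p; rewrite enc_nat_pred.
- exact: size_bounded_cst.
- move=> x b [s k] _; rewrite /e /= !tsize_enc_nat addn0.
  have : tsize (enc_bits (behead s)) <= tsize (enc_bits s) by case: s => //= *; lia.
  by case: b => [|/=]; [case: head => /=|]; lia.
Qed.

Definition far_words (l : nat) (w : seq bool) (W : seq (seq bool)) :=
  foldl (fun R v => if 0 < l - agree v w then v :: R else R) [::] W.

Lemma computes_far_words X (u : X -> tree) l w W :
  computes u (fun x => enc_nat (l x)) -> computes u (fun x => enc_bits (w x)) ->
  computes u (fun x => enc_words (W x)) ->
  computes u (fun x => enc_words (far_words (l x) (w x) (W x))).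
Proof.
move=> ul uw uW.
apply: (@computes_foldl_add _ _ _ enc_bits enc_words _ _ _
   (fun x R v => if 0 < l x - agree v (w x) then v :: R else R) uW _ _
   (fun x => tsize (enc_words (W x)))).
- exact: computes_const.
- apply: (@computes_ext _ _ (fun p => if is_node (enc_nat (l p.1.1 - agree p.2 (w
  p.1.1)))
      then enc_words (p.2 :: p.1.2) else enc_words p.1.2)).
    by move=> p; rewrite is_node_enc_nat; case: ifP.
  apply: computes_if.
  + apply: computes_agree_lt; first exact: (@computes_ev _ VRR).
      exact: (@computes_wk _ _ (fun p => p.1.1) _ _ _ uw).
    exact: (@computes_wk _ _ (fun p => p.1.1) _ _ _ ul).
  + exact: (@computes_ev _ (ENode VRR VRL)).
  + exact: (@computes_ev _ VRL).
- exact: computes_size uW.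
- move=> x v R v_in; case: ifP => _ /=; last by lia.
  have : tsize (enc_bits v) < tsize (enc_words (W x)) by apply: tsize_enc_seq_mem.
  by lia.
Qed.

Lemma far_wordsE l w W : far_words l w W = rev [seq v <- W | agree v w < l].
Proof.
rewrite /far_words /rev; move: [::] => R; elim: W R => //= v W IH R.
by rewrite IH subn_gt0; case: ifP.
Qed.

(** * Greedy selection and the points of the instance *)

Definition enc_entry (p : nat * seq bool) : tree := Node (enc_nat p.1) (enc_bits p.2).
Local Notation enc_book := (enc_seq enc_entry).

Definition has_key (A : seq (nat * seq bool)) (i : nat) : bool :=
  foldl (fun b p => if p.1 == i then true else b) false A.

Lemma has_keyE A i : has_key A i = (i \in map fst A).
Proof.
rewrite /has_key -[RHS]orbF; move: false => b.
elim: A b => [|p A IH] b //=; rewrite IH inE eq_sym.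
by case: eqP => /=; rewrite ?orbT.
Qed.

(** The default is the empty word, so an element that received no word contributes no ones. *)
Definition lookup (A : seq (nat * seq bool)) (i : nat) : seq bool :=
  foldl (fun w p => if p.1 == i then p.2 else w) [::] A.

Section Book.
Variables (X : Type) (u : X -> tree) (A : X -> seq (nat * seq bool)) (i : X -> nat).
Hypothesis uA : computes u (fun x => enc_book (A x)).
Hypothesis ui : computes u (fun x => enc_nat (i x)).

Let key_test Z (eZ : Z -> tree) : computes
  (fun p : X * Z * (nat * seq bool) =>
     Node (u p.1.1) (Node (eZ p.1.2) (enc_entry p.2)))
  (fun p => enc_bool (p.2.1 == i p.1.1)).
Proof.
apply: computes_eqn; first exact: (@computes_ev _ (ELeft VRR)).
exact: (@computes_wk _ _ (fun p : X * Z * (nat * seq bool) => p.1.1) _ _ _ ui).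
Qed.

Lemma computes_has_key : computes u (fun x => enc_bool (has_key (A x) (i x))).
Proof.
apply: (@computes_foldl_add _ _ _ enc_entry enc_bool _ _ _
  (fun x b p => if p.1 == i x then true else b) uA _ _ (fun=> 3)).
- exact: computes_const.
- apply: (@computes_ext _ _ (fun p => if p.2.1 == i p.1.1 then enc_bool true
    else enc_bool p.1.2)) => [p|]; first by case: ifP.
  apply: computes_if_bool (key_test enc_bool) _ _; first exact: computes_const.
  exact: (@computes_ev _ VRL).
- exact: size_bounded_cst.
- by move=> x p b _; apply: leq_trans (tsize_enc_bool _) _; lia.
Qed.

Lemma computes_lookup : computes u (fun x => enc_bits (lookup (A x) (i x))).
Proof.
apply: (@computes_foldl_add _ _ _ enc_entry enc_bits _ _ _
  (fun x w p => if p.1 == i x then p.2 else w) uA _ _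
  (fun x => tsize (enc_book (A x)))).
- exact: computes_const.
- apply: (@computes_ext _ _ (fun p => if p.2.1 == i p.1.1 then enc_bits p.2.2
    else enc_bits p.1.2)) => [p|]; first by case: ifP.
  apply: computes_if_bool (key_test enc_bits) _ _; first exact: (@computes_ev _
    (ERight VRR)).
  exact: (@computes_ev _ VRL).
- exact: computes_size uA.
- move=> x p w p_in; case: ifP => _; last by lia.
  have : tsize (enc_entry p) < tsize (enc_book (A x)) by apply: tsize_enc_seq_mem.
  by rewrite /enc_entry /=; lia.
Qed.

End Book.

(** [flat E] lists elements with repetitions, hence the test for an existing key. The branch for an
    exhausted list is a mere default; the choice of [q] excludes it. *)
Definition code_step (l : nat) (S : seq (nat * seq bool) * seq (seq bool)) (i : nat) :=
  if has_key S.1 i then S else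
  if S.2 is w :: W then ((i, w) :: S.1, far_words l w W) else S.

Definition enc_state (S : seq (nat * seq bool) * seq (seq bool)) : tree :=
  Node (enc_book S.1) (enc_words S.2).

Lemma tsize_far_words l w W : tsize (enc_words (far_words l w W)) <= tsize
  (enc_words W).
Proof.
suff H R : tsize (enc_words (foldl (fun R v => if 0 < l - agree v w then v :: R
  else R) R W))
    < tsize (enc_words R) + tsize (enc_words W) by have := H [::].
elim: W R => [|v W IH] R /=; first by lia.
apply: leq_trans (IH _) _; case: ifP => _ /=; lia.
Qed.

Lemma computes_code_step X (u : X -> tree) l S i :
  computes u (fun x => enc_nat (l x)) -> computes u (fun x => enc_state (S x)) ->
  computes u (fun x => enc_nat (i x)) ->
  computes u (fun x => enc_state (code_step (l x) (S x) (i x))).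
Proof.
move=> ul uS ui; have uA := computes_left uS; have uW := computes_right uS.
have uw : computes u (fun x => enc_bits (head [::] (S x).2)).
  by apply: computes_trans uW _; apply: (@computes_ev _ VL) => x; case: (S x).2.
have uW' : computes u (fun x => enc_words (behead (S x).2)).
  by apply: computes_trans uW _; apply: (@computes_ev _ VR) => x; case: (S x).2.
apply: computes_ext (computes_if_bool (computes_has_key uA ui) uS (computes_if uW
  (computes_pair (computes_pair (computes_pair ui uw) uA)
     (computes_far_words ul uw uW')) uS)) => x.
by rewrite /code_step; case: ifP => // _; case: (S x) => A [|w W].
Qed.

Lemma tsize_code_step l S i :
  tsize (enc_state (code_step l S i)) <= tsize (enc_state S) + (tsize (enc_nat i)).+2.
Proof.
rewrite /code_step; case: ifP => _; first by lia.
case: S => A [|w W] /=; first by lia.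
by rewrite /enc_entry /=; move: (tsize_far_words l w W); lia.
Qed.

Definition flat (E : seq (seq nat)) : seq nat := foldl (fun R T => catrev T R) [::] E.

Lemma mem_flat E i : (i \in flat E) = has (fun T => i \in T) E.
Proof.
rewrite /flat; suff H R : (i \in foldl (fun R T => catrev T R) R E)
    = (i \in R) || has (fun T => i \in T) E by rewrite H.
elim: E R => [|T E IH] R /=; first by rewrite orbF.
by rewrite IH catrevE mem_cat mem_rev orbA [X in X || _]orbC.
Qed.

Lemma size_flat E z : {in E, forall T, size T = z} -> size (flat E) = size E * z.
Proof.
rewrite /flat => hE; suff H R : size (foldl (fun R T => catrev T R) R E)
    = size E * z + size R by rewrite H addn0.
elim: E hE R => [|T E IH] hE R //=.
rewrite IH => [|T' T'_in]; last by apply: hE; rewrite inE T'_in orbT.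
by rewrite catrevE size_cat size_rev (hE T (mem_head _ _)) mulSn addnCA addnA.
Qed.

Local Notation enc_sets := (enc_seq (enc_seq enc_nat)).

Lemma computes_flat X (u : X -> tree) E : computes u (fun x => enc_sets (E x)) ->
  computes u (fun x => enc_seq enc_nat (flat (E x))).
Proof.
move=> uE; apply: (@computes_foldl_add _ _ _ (enc_seq enc_nat) (enc_seq enc_nat)
  _ _ _ (fun _ R T => catrev T R) uE _ _ (fun x => tsize (enc_sets (E x)))).
- exact: computes_const.
- apply: computes_catrev; first exact: (@computes_ev _ VRR).
  exact: (@computes_ev _ VRL).
- exact: computes_size uE.
- move=> x T R T_in.
  have hT : tsize (enc_seq enc_nat T) < tsize (enc_sets (E x)) by apply:
    tsize_enc_seq_mem.
  suff : tsize (enc_seq enc_nat (catrev T R)) <= tsize (enc_seq enc_nat R) + tsize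
    (enc_seq enc_nat T) by lia.
  elim: T {T_in hT} R => [|k T IH] R; first by rewrite /=; lia.
  by apply: leq_trans (IH (k :: R)) _ => /=; lia.
Qed.

Definition bits_or_step (s : seq bool * seq bool) (b : bool) :=
  (behead s.1, (b || head false s.1) :: s.2).

Definition bits_or (v w : seq bool) : seq bool := rev (foldl bits_or_step (w, [::])
  v).2.

Lemma size_bits_or v w : size (bits_or v w) = size v.
Proof.
rewrite /bits_or size_rev -[RHS]addn0 -[0]/(size (@nil bool)).
by elim: v w [::] => //= b v IH w R; rewrite IH /=; lia.
Qed.

Lemma nth_bits_or v w i : size w <= size v ->
  nth false (bits_or v w) i = nth false v i || nth false w i.
Proof.
rewrite /bits_or.
have H R : rev (foldl bits_or_step (w, R) v).2 =
    rev R ++ mkseq (fun i => nth false v i || nth false w i) (size v).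
  elim: v w R => [|b v IH] w R; first by rewrite /= cats0.
  rewrite [foldl _ _ _]/= IH rev_cons cat_rcons; congr (_ ++ _).
  rewrite -(nth0 false w) /mkseq [size (b :: v)]/= [iota 0 _.+1]/= (iotaDl 1 0).
  rewrite map_cons -map_comp; congr (_ :: _); apply: eq_map => j.
  by rewrite /= nth_behead.
move=> le_wv; rewrite H /=; have [lt_i|le_i] := ltnP i (size v).
  by rewrite nth_mkseq.
by rewrite !nth_default ?size_mkseq // (leq_trans le_wv).
Qed.

Lemma computes_bits_or X (u : X -> tree) v w :
  computes u (fun x => enc_bits (v x)) -> computes u (fun x => enc_bits (w x)) ->
  computes u (fun x => enc_bits (bits_or (v x) (w x))).
Proof.
move=> uv uw; apply: computes_rev.
pose e (s : seq bool * seq bool) := Node (enc_bits s.1) (enc_bits s.2).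
apply: (@computes_right _ _
   (fun x => enc_bits (foldl bits_or_step (w x, [::]) (v x)).1)).
apply: (@computes_foldl_add _ _ _ enc_bool e _ _ _ (fun=> bits_or_step) uv _ _
  (fun=> 4)).
- exact: computes_pair uw (computes_const _ _).
- apply: computes_pair.
    apply: (@computes_ev _ (ERight (ELeft VRL))) => -[[x [s k]] b] /=.
    by rewrite /ev /=; case: s.
  apply: (@computes_pair _ _ (fun p => enc_bool (p.2 || head false p.1.2.1))
     (fun p => enc_bits p.1.2.2)); last exact: (@computes_ev _ (ERight VRL)).
  have hb : computes (fun p : X * (seq bool * seq bool) * bool =>
      Node (u p.1.1) (Node (e p.1.2) (enc_bool p.2))) (fun p => enc_bool p.2).
    exact: (@computes_ev _ VRR).
  apply: (@computes_ext _ _ (fun p => if p.2 then enc_bool p.2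
    else enc_bool (head false p.1.2.1))) => [[[x s] []]|] //.
  apply: computes_if_bool (hb) (hb) _.
  by apply: (@computes_ev _ (ELeft (ELeft VRL))) => -[[x [[|? ?] k]] b].
- exact: size_bounded_cst.
- move=> x b [s k] _; rewrite /e /=.
  have : tsize (enc_bits (behead s)) <= tsize (enc_bits s) by case: s => //= *; lia.
  by move: (tsize_enc_bool (b || head false s)); lia.
Qed.

Definition point (A : seq (nat * seq bool)) (d : nat) (T : seq nat) : seq bool :=
  foldl (fun v i => bits_or v (lookup A i)) (nseq d false) T.

Lemma size_point A d T : size (point A d T) = d.
Proof.
rewrite /point -[RHS](size_nseq d false).
by elim: T (nseq _ _) => //= i T IH v; rewrite IH size_bits_or.
Qed.

Lemma computes_point X (u : X -> tree) A d T :
  computes u (fun x => enc_book (A x)) -> computes u (fun x => enc_nat (d x)) ->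
  computes u (fun x => enc_seq enc_nat (T x)) ->
  computes u (fun x => enc_bits (point (A x) (d x) (T x))).
Proof.
move=> uA ud uT.
apply: (@computes_foldl _ _ _ enc_nat enc_bits _ _ _
  (fun x v i => bits_or v (lookup (A x) i)) uT _ _
  (fun x => 4 * tsize (enc_nat (d x)) + 1)).
- by apply: computes_ext ud => x; elim: (d x) => //= k ->.
- apply: computes_bits_or; first exact: (@computes_ev _ VRL).
  apply: computes_lookup; last exact: (@computes_ev _ VRR).
  exact: (@computes_wk _ _ (fun p => p.1.1) _ _ _ uA).
- have sd := computes_size ud.
  by do ![exact: sd || exact: size_bounded_cst || apply: poly_bounded_add ||
    apply: poly_bounded_mul].
- move=> x i; rewrite -/(point (A x) (d x) (take i (T x))).
  apply: leq_trans (tsize_enc_bits _) _; rewrite size_point leq_add2r leq_mul2l /=.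
  by rewrite tsize_enc_nat; lia.
Qed.

Section Reduction.
Variables (c q : nat).

Definition code_log (E : seq (seq nat)) : nat := rlog (size E).
Definition codebook (E : seq (seq nat)) : seq (nat * seq bool) :=
  (foldl (code_step (code_log E)) ([::], words q (c * code_log E)) (flat E)).1.
Definition code_dim (E : seq (seq nat)) : nat := q * (c * code_log E).
Definition points (E : seq (seq nat)) : seq (seq bool) :=
  rev [seq point (codebook E) (code_dim E) T | T <- E].

Hypothesis q_gt0 : 0 < q.

Lemma computes_points X (u : X -> tree) E : computes u (fun x => enc_sets (E x)) ->
  computes u (fun x => enc_words (points (E x))).
Proof.
move=> uE; have ul : computes u (fun x => enc_nat (code_log (E x))).
  exact: computes_rlog (computes_size_seq uE).
have um := computes_muln_cst c ul; have ud := computes_muln_cst q um.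
have uW : computes u (fun x => enc_words (words q (c * code_log (E x)))).
  apply: computes_words => //.
  (* The crude bound [q <= 2 ^ q] suffices: with $2^l \le |E|$ it gives $q^{cl} \le |E|^{qc}$, whose
     exponent is constant. *)
  apply: (@poly_bounded_le _ _ _ (fun x => tsize (enc_sets (E x)) ^ (q * c))).
    move=> x; set l := code_log (E x); apply: (@leq_trans ((2 ^ q) ^ (c * l))).
      by rewrite leq_exp2rW // ltnW // ltn_expl.
    rewrite -expnM mulnA mulnC expnM leq_exp2rW //.
    rewrite /l /code_log; case: (E x) => [|T E']; first exact: tsize_gt0.
    by apply: leq_trans (ltnW (size_enc_seq _ _)); case/andP: (rlogP (ltn0Sn (size
      E'))).
  by apply: poly_bounded_exp; [move=> x; apply: tsize_gt0 | apply: computes_size uE].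
have uflat := computes_flat uE.
have uA : computes u (fun x => enc_book (codebook (E x))).
  apply: (@computes_left _ _ _ (fun x => enc_words (foldl (code_step (code_log (E x)))
    ([::], words q (c * code_log (E x))) (flat (E x))).2)).
  apply: (@computes_foldl_add _ _ _ enc_nat enc_state _ _ _
    (fun x => code_step (code_log (E x))) uflat _ _
    (fun x => tsize (enc_seq enc_nat (flat (E x))) + 2)).
  - exact: computes_pair (computes_const _ _) uW.
  - apply: computes_code_step; last exact: (@computes_ev _ VRR).
      exact: (@computes_wk _ _ (fun p => p.1.1) _ _ _ ul).
    exact: (@computes_ev _ VRL).
  - have sf := computes_size uflat.
    by do ![exact: sf || exact: size_bounded_cst || apply: poly_bounded_add].
  - move=> x i S i_in; apply: leq_trans (tsize_code_step _ _ _) _.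
    have : tsize (enc_nat i) < tsize (enc_seq enc_nat (flat (E x))).
      by apply: tsize_enc_seq_mem.
    by lia.
apply: (computes_map (f := fun x => point (codebook (E x)) (code_dim (E x))) uE).
apply: computes_point; last exact: (@computes_ev _ VR).
  exact: (@computes_wk _ _ (fun p => p.1) _ _ _ uA).
exact: (@computes_wk _ _ (fun p => p.1) _ _ _ ud).
Qed.

End Reduction.

(** * Success of the greedy selection *)

Lemma agree_cat s1 s2 w1 w2 : size s1 = size s2 ->
  agree (s1 ++ w1) (s2 ++ w2) = agree s1 s2 + agree w1 w2.
Proof. by move=> e; rewrite /agree zip_cat // count_cat. Qed.

Lemma agree_one_hot q i j : i < q -> agree (one_hot q i) (one_hot q j) = (i == j).
Proof.
move=> iq; rewrite /agree /one_hot zip_map count_map.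
case: eqP => [<-|ij].
  rewrite (eq_count (a2 := pred1 i)) => [|k] /=; last by rewrite andbb.
  by rewrite count_uniq_mem ?iota_uniq // mem_iota iq.
rewrite (eq_count (a2 := pred0)) ?count_pred0 // => k /=.
by case: eqP => //= ->; apply/eqP.
Qed.

Lemma agreeC v w : agree v w = agree w v.
Proof.
rewrite /agree; elim: v w => [|b v IH] [|b' w] //=.
by rewrite IH andbC.
Qed.

Lemma agree0s v : agree [::] v = 0.
Proof. by case: v. Qed.

Lemma agree_self q m w : w \in words q m -> agree w w = m.
Proof.
elim: m w => [|m IH] w; first by rewrite inE => /eqP ->.
case/mem_extend_words => v /IH hv [s /mapP[i + ->] ->]; rewrite mem_iota => iq.
by rewrite agree_cat // hv agree_one_hot // eqxx.
Qed.

(* Weighting each word by [q] to the number of agreements factors over the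
   letters: each letter contributes [q] once and [1] for the [q - 1] others. *)
Lemma sum_agree q m w : w \in words q m ->
  \sum_(v <- words q m) q ^ agree v w = (q + q.-1) ^ m.
Proof.
elim: m w => [|m IH] w.
  by rewrite inE => /eqP ->; rewrite /words /= big_seq1.
case/mem_extend_words => w' hw' [s /mapP[i + ->] ->]; rewrite mem_iota /= => iq.
rewrite sum_extend_words expnSr -(IH _ hw') big_distrl /=.
apply: eq_big_seq => v hv.
have e0q : iota 0 q = index_iota 0 q by rewrite /index_iota subn0.
rewrite big_map e0q.
under eq_bigr => j _ do rewrite agree_cat ?size_map ?size_iota // expnD.
rewrite -big_distrl /= mulnC; congr (_ * _).
have -> : \sum_(0 <= j < q) q ^ agree (one_hot q j) (one_hot q i)
    = \sum_(0 <= j < q) q ^ (j == i).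
  by apply: eq_big_nat => j /= jq; rewrite agree_one_hot.
rewrite big_mkord (bigD1 (Ordinal iq)) //= eqxx expn1; congr (_ + _).
rewrite (eq_bigr (fun=> 1)) => [|j /negbTE ji].
  by rewrite sum1_card cardC1 card_ord.
by rewrite -val_eqE /= in ji; rewrite ji.
Qed.

(** Markov's inequality for the weight [q ^ agree v w], whose total is at most $(2q)^m$. *)
Lemma count_agree_ge q m l w : 0 < q -> w \in words q m ->
  count (fun v => l <= agree v w) (words q m) * q ^ l <= 2 ^ m * q ^ m.
Proof.
move=> q_gt0 hw; rewrite -expnMn.
apply: (@leq_trans ((q + q.-1) ^ m)); last first.
  by apply: leq_exp2rW; lia.
rewrite -(sum_agree hw) -sum1_count big_distrl /=.
rewrite big_mkcond /=; apply: leq_sum => v _; case: ifP => // le_l.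
by rewrite mul1n leq_pexp2l.
Qed.

(** At powers of two above 1, [rlog] is one below the logarithm; in particular [rlog 2 = 0], hence
    the strict bound. *)
Lemma code_log_gt0 E : 2 < size E -> 0 < code_log E.
Proof.
move=> E_gt2; have := rlogP (ltn_trans (isT : 0 < 2) E_gt2).
by rewrite -/(code_log E); case: (code_log E) => //=; lia.
Qed.

Section Codebook.
Variables (c q z : nat) (E : seq (seq nat)).
Let l := code_log E.
Let m := c * l.
Hypothesis qE : q = 2 ^ (2 * z + c.+1).
Hypothesis c_gt0 : 0 < c.
Hypothesis z_gt0 : 0 < z.
Hypothesis E_gt2 : 2 < size E.
Hypothesis size_E : {in E, forall T, size T = z}.

Let W0 := words q m.
Let bad := \max_(w <- W0) count (fun v => l <= agree v w) W0.

(** This inequality dictates [q]. By Markov's bound at most $2^m q^{m-l}$ words are too close to a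
    given one, and $z |E| 2^m < 2^{z+l+1+cl} \le q^l$. *)
Let bad_lt : size (flat E) * bad < q ^ m.
Proof.
have q_gt0 : 0 < q by rewrite qE expn_gt0.
have hb : bad * q ^ l <= 2 ^ m * q ^ m.
  rewrite /bad big_seq; elim/big_ind: _ => [|x y hx hy|w hw] //.
    by rewrite maxnMl geq_max hx.
  exact: count_agree_ge.
have sizeflat : size (flat E) * 2 ^ m < q ^ l.
  rewrite (size_flat size_E) qE -expnM.
  have /andP[_ hE] := rlogP (ltn_trans (isT : 0 < 2) E_gt2); rewrite -/(code_log E)
    -/l in hE.
  apply: (@leq_ltn_trans (2 ^ l.+1 * z * 2 ^ m)); first by rewrite !leq_mul.
  have -> : 2 ^ l.+1 * z * 2 ^ m = z * 2 ^ (l.+1 + m).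
    by rewrite [2 ^ _ * z]mulnC -mulnA -expnD.
  apply: (@leq_trans (2 ^ z * 2 ^ (l.+1 + m))).
    by rewrite ltn_pmul2r ?expn_gt0 // ltn_expl.
  rewrite -expnD leq_pexp2l // /m !mulnDl mulSn.
  have : 2 * z * 1 <= 2 * z * l by rewrite leq_mul // (code_log_gt0 E_gt2).
  by lia.
rewrite -(ltn_pmul2r (m := q ^ l)) ?expn_gt0 ?q_gt0 // -mulnA.
apply: (@leq_ltn_trans (size (flat E) * (2 ^ m * q ^ m))); first by rewrite
  leq_mul2l hb orbT.
by rewrite mulnA [q ^ m * _]mulnC ltn_pmul2r // expn_gt0 q_gt0.
Qed.

(** The comparison of all counts says that the remaining words form a sub-multiset of [W0], so [bad]
    still bounds what a choice removes. The last clause is the greedy potential: each chosen word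
    has cost at most [bad] candidates. *)
Definition good_state (S : seq (nat * seq bool) * seq (seq bool)) (s : seq nat) :=
  [/\ map fst S.1 =i s,
      {in S.1, forall p, p.2 \in W0} ,
      {in S.1 & S.1, forall p p', p.1 != p'.1 -> agree p.2 p'.2 < l} &
   [/\ {in S.1, forall p, {in S.2, forall w, agree p.2 w < l}},
      forall a, count a S.2 <= count a W0 &
      q ^ m <= size S.2 + size S.1 * bad]].

Let good_code_step S s i : size S.1 < size (flat E) -> good_state S s ->
  good_state (code_step l S i) (i :: s).
Proof.
case: S => A W /= sA [/= As AW0 AA [/= AW WW0 sW]]; rewrite /code_step has_keyE.
case: ifPn => /= iA.
  split=> // k; rewrite inE As; case: eqP => // ->; by rewrite -As.
case: W => [|w W] /= in AW WW0 sW *.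
  (* With no candidate left, the potential would give [q ^ m <= size A * bad], against [bad_lt]. *)
  have := leq_mul (ltnW sA) (leqnn bad); move: bad_lt; simpl in sW; lia.
have wW0 : w \in W0.
  by rewrite -has_pred1 has_count; apply: leq_trans (WW0 (pred1 w)); rewrite /= eqxx.
have farE v : v \in far_words l w W = (agree v w < l) && (v \in W).
  by rewrite far_wordsE mem_rev mem_filter.
split=> /=.
- by move=> k; rewrite !inE As.
- by move=> p; rewrite inE => /predU1P[->|/AW0].
- move=> p p'; rewrite !inE => /predU1P[->|pA] /predU1P[->|p'A] //=.
  + by rewrite eqxx.
  + by move=> _; rewrite agreeC; apply: AW; rewrite ?mem_head.
  + by move=> _; apply: AW; rewrite ?mem_head.
  + exact: AA.
split.
- move=> p; rewrite inE => /predU1P[->|pA] v; rewrite farE => /andP[vw vW].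
    by rewrite agreeC.
  by apply: AW => //; rewrite inE vW orbT.
- move=> a; apply: leq_trans (WW0 a); rewrite far_wordsE count_rev /=.
  apply: leq_trans (leq_addl _ _); rewrite count_filter.
  by apply: sub_count => v /andP[].
- have : count (fun v => l <= agree v w) (w :: W) <= bad.
    apply: leq_trans (WW0 _) _; rewrite /bad.
    by rewrite (big_rem w) //= leq_maxl.
  (* The chosen word leaves the list as well; since it agrees with itself in [m >= l] places, it is
     already counted in [bad]. *)
  have ww : l <= agree w w by rewrite (agree_self wW0) /m leq_pmull.
  rewrite /= ww far_wordsE size_rev size_filter mulSn.
  have := count_predC (fun v => agree v w < l) W.
  have -> : count (predC (fun v => agree v w < l)) W = count (fun v => l <= agree v
    w) W.
    by apply: eq_count => v /=; rewrite -leqNgt.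
  simpl in sW; lia.
Qed.

Let good_foldl r s S : size S.1 <= size s -> size s + size r = size (flat E) ->
  good_state S s -> good_state (foldl (code_step l) S r) (catrev r s).
Proof.
elim: r s S => //= i r IH s S sS e goodS; apply: IH.
- rewrite /code_step; case: ifP => _; first exact: leqW.
  by case: S sS {goodS} => A [|w W] /=; [apply: leqW | rewrite ltnS].
- by rewrite /= -e addSnnS.
- by apply: good_code_step => //; rewrite (leq_ltn_trans sS) // -e; lia.
Qed.

Lemma lookupP (A : seq (nat * seq bool)) i :
  if i \in map fst A then is_true ((i, lookup A i) \in A) else lookup A i = [::].
Proof.
suff H w : let w' := foldl (fun w p => if p.1 == i then p.2 else w) w A in
    if i \in map fst A then is_true ((i, w') \in A) else w' = w by exact: H.
elim: A w => [|[j v] A IH] w //=.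
have /= := IH (if j == i then v else w); rewrite !inE [i == j]eq_sym.
case: (i \in map fst A) => [->|->]; first by rewrite !orbT.
by rewrite orbF; case: eqP => // ->; rewrite eqxx.
Qed.

Lemma codebookP : let w := lookup (codebook c q E) in
  [/\ forall i, i \notin flat E -> w i = [::],
      forall i, i \in flat E -> size (w i) = code_dim c q E /\ agree (w i) (w i) = m &
      forall i j, i != j -> agree (w i) (w j) <= l].
Proof.
rewrite /codebook -/l -/m -/W0.
have [||As AW0 AA _] := good_foldl (r := flat E) (s := [::]) (S := ([::], W0))
  (leq0n _).
- by [].
- by split=> //; split=> //=; rewrite addn0 card_words.
set S := foldl _ _ _ in As AW0 AA *; rewrite -/(rev _) in As.
set w := lookup S.1.
have wS i : if i \in flat E then is_true ((i, w i) \in S.1) else w i = [::].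
  by have := lookupP S.1 i; rewrite As mem_rev.
split=> [i iE|i iE|i j ij]; have := wS i.
- by rewrite (negbTE iE).
- rewrite iE => /AW0 /= wW; rewrite (size_words wW) (agree_self wW).
  by rewrite /code_dim -/l -/m mulnC.
- have := wS j; case: ifP => _ hj; case: ifP => _ hi; rewrite ?hi ?hj.
  + exact: ltnW (AA _ _ hi hj ij).
  + by rewrite agree0s.
  + by rewrite agreeC agree0s.
  + by rewrite agree0s.
Qed.

End Codebook.

Definition bitset d (v : seq bool) : {set 'I_d} := [set j : 'I_d | nth false v j].
Arguments bitset : clear implicits.

Lemma card_bitsetI d v w : size v <= d -> #|bitset d v :&: bitset d w| = agree v w.
Proof.
move=> vd; transitivity (\sum_(j < d) (nth false v j && nth false w j : nat)).
  rewrite -sum1_card big_mkcond /=; apply: eq_bigr => j _.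
  by rewrite !inE; case: (_ && _).
elim: d v w vd => [|d IH] [|b v] w vd; first by rewrite big_ord0 agree0s.
- by [].
- by rewrite agree0s big1 // => j _; rewrite nth_nil.
rewrite big_ord_recl /=; case: w => [|b' w] /=.
  by rewrite agreeC agree0s andbF big1 // => j _; rewrite andbF.
by rewrite /agree /= -/(agree v w) -IH.
Qed.

Lemma bitset_point A d (T : seq nat) :
  (forall i, size (lookup A i) <= d) ->
  bitset d (point A d T) = [set j | has (fun i => j \in bitset d (lookup A i)) T].
Proof.
move=> hA; apply/setP => j; rewrite !inE /point.
suff H v : size v = d -> nth false (foldl (fun v i => bits_or v (lookup A i)) v T) j
    = nth false v j || has (fun i => j \in bitset d (lookup A i)) T.
  by rewrite H ?size_nseq // nth_nseq if_same.
elim: T v => [|i T IH] v /= vd; first by rewrite orbF.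
by rewrite IH ?size_bits_or // nth_bits_or ?vd // inE orbA.
Qed.

(** * Distances between unions of code words *)

Definition set_dist (T : finType) (A B : {set T}) : nat := #|A :\: B| + #|B :\: A|.

Lemma bin_le_exp n k : 'C(n, k) <= n ^ k.
Proof.
apply: (@leq_trans (n ^_ k)); first by rewrite -bin_ffact leq_pmulr // fact_gt0.
elim: k => // k IH; rewrite ffactnSr expnSr leq_mul //; lia.
Qed.

Lemma card_supersets (T : finType) (A : {set T}) z :
  #|[set B : {set T} | (#|B| == z) && (A \subset B)]| <= #|T| ^ (z - #|A|).
Proof.
apply: leq_trans (bin_le_exp _ _); rewrite -card_draws.
set D := [set B | _]; have inj : {in D &, injective (fun B => B :\: A)}.
  move=> B C; rewrite !inE => /andP[_ /setUidPr AB] /andP[_ /setUidPr AC] e.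
  by rewrite -AB -AC -(setID B A) -(setID C A) !setUA !(setUC A) -!setUA
    ![A :|: _]setUC e -AB -AC; apply/setP => x; rewrite !inE;
    move/setP/(_ x): e; rewrite !inE; case: (x \in A); case: (x \in B); case: (x \in C).
rewrite -(card_in_imset inj); apply/subset_leq_card/subsetP => _ /imsetP[B hB ->].
by move: hB; rewrite !inE => /andP[/eqP <- AB]; rewrite cardsD (setIidPr AB).
Qed.

Lemma leq_card_bigcup (I T : finType) (D : {set I}) (F : I -> {set T}) :
  #|\bigcup_(i in D) F i| <= \sum_(i in D) #|F i|.
Proof.
elim/big_rec2: _ => [|i n A _ IH]; first by rewrite cards0.
by apply: leq_trans (leq_card_setU _ _) _; rewrite leq_add2l.
Qed.

(** Such a set contains one of the at most [2 ^ #|B|] subsets of [B] with [y.+1] elements, and each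
    of these extends to a [z]-set in at most $|T|^{z-y-1}$ ways. *)
Lemma card_heavy (T : finType) (B : {set T}) z y :
  #|[set A : {set T} | (#|A| == z) && (y < #|A :&: B|)]|
    <= 2 ^ #|B| * #|T| ^ (z - y - 1).
Proof.
pose D := [set A : {set T} | (A \subset B) && (#|A| == y.+1)].
apply: (@leq_trans #|\bigcup_(A in D) [set C : {set T} | (#|C| == z) && (A \subset
  C)]|).
  apply/subset_leq_card/subsetP => C; rewrite inE => /andP[Cz hC].
  have [A AS cA] : exists2 A : {set T}, A \subset C :&: B & #|A| = y.+1.
    have : 0 < #|[set A : {set T} | A \subset C :&: B & #|A| == y.+1]|.
      by rewrite cards_draws bin_gt0.
    by case/card_gt0P => A; rewrite inE => /andP[AS /eqP cA]; exists A.
  move: AS; rewrite subsetI => /andP[AC AB].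
  by apply/bigcupP; exists A; rewrite !inE ?AB ?cA ?AC ?Cz ?eqxx.
apply: leq_trans (leq_card_bigcup _ _) _.
apply: (@leq_trans (\sum_(A in D) #|T| ^ (z - y - 1))).
  apply: leq_sum => A; rewrite inE => /andP[_ /eqP cA].
  by apply: leq_trans (card_supersets _ _) _; rewrite cA subn1 -subnS.
rewrite sum_nat_const leq_mul2r -card_powerset; apply/orP; right.
by apply/subset_leq_card/subsetP => A; rewrite !inE => /andP[].
Qed.

Lemma set_card_ind (I : finType) (P : {set I} -> Prop) :
  P set0 -> (forall i (S : {set I}), i \notin S -> P S -> P (i |: S)) ->
  forall S, P S.
Proof.
move=> P0 PU S; move: {2}#|S| (erefl #|S|) => k; elim: k S => [|k IH] S.
  by move/eqP; rewrite cards_eq0 => /eqP ->.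
move=> cS; have /card_gt0P[i iS] : 0 < #|S| by rewrite cS.
rewrite -(setD1K iS); apply: PU; first by rewrite !inE eqxx.
by apply: IH; move: cS; rewrite (cardsD1 i) iS => -[].
Qed.

Section Code.
Variables (I T : finType) (w : I -> {set T}) (m l : nat).
Hypothesis size_w : forall i, #|w i| <= m.
Hypothesis disj_w : forall i j, i != j -> #|w i :&: w j| <= l.

Definition codeunion (S : {set I}) : {set T} := \bigcup_(i in S) w i.

Lemma codeunionI_upper (S : {set I}) (C : {set T}) :
  #|codeunion S :&: C| <= \sum_(i in S) #|w i :&: C|.
Proof. by rewrite big_distrl /= leq_card_bigcup. Qed.

(** A new word meets the union of the old ones in at most [#|S| * l] places; these losses sum to
    less than the quadratic term. *)
Lemma codeunionI_lower (S : {set I}) (C : {set T}) :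
  \sum_(i in S) #|w i :&: C| <= #|codeunion S :&: C| + #|S| ^ 2 * l.
Proof.
elim/set_card_ind: S => [|i S iS IH]; first by rewrite big_set0.
rewrite big_setU1 //= /codeunion big_setU1 //= -/(codeunion S) setIUl cardsU1 iS.
have h : #|(w i :&: C) :&: (codeunion S :&: C)| <= #|S| * l.
  apply: (@leq_trans #|codeunion S :&: w i|).
    by apply/subset_leq_card/subsetP => x; rewrite !inE => /andP[/andP[-> _]
      /andP[-> _]].
  apply: leq_trans (codeunionI_upper _ _) _.
  rewrite -sum_nat_const; apply: leq_sum => j jS.
  by apply: disj_w; apply: contraNneq iS => <-.
have := cardsUI (w i :&: C) (codeunion S :&: C).
rewrite !expnS !expn0 !muln1 mulnDl !mulnDr; lia.
Qed.

Lemma card_codeunion_upper (S : {set I}) : #|codeunion S| <= #|S| * m.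
Proof.
rewrite -sum_nat_const; apply: leq_trans (leq_card_bigcup _ _) _.
exact: leq_sum.
Qed.

Lemma card_codeunion_lower (S : {set I}) : (forall i, i \in S -> #|w i| = m) ->
  #|S| * m <= #|codeunion S| + #|S| ^ 2 * l.
Proof.
move=> wm; have := codeunionI_lower S setT; rewrite setIT.
under eq_bigr => i iS do rewrite setIT wm //.
by rewrite sum_nat_const.
Qed.

Lemma set_distE (A B : {set T}) : set_dist A B + 2 * #|A :&: B| = #|A| + #|B|.
Proof. by rewrite /set_dist -(cardsID B A) -(cardsID A B) (setIC B A); lia. Qed.

Lemma codeunion_dist_subset (S S' : {set I}) : S \subset S' ->
  set_dist (codeunion S') (codeunion S) <= (#|S'| - #|S|) * m.
Proof.
move=> SS'; rewrite -(cardsDS SS') /set_dist.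
have -> : codeunion S :\: codeunion S' = set0.
  by apply/eqP; rewrite setD_eq0; apply/bigcupsP => i /(subsetP SS'); apply: bigcup_sup.
rewrite cards0 addn0; apply: leq_trans (card_codeunion_upper _).
apply/subset_leq_card/subsetP => x; rewrite inE => /andP[xS /bigcupP[i iS' xi]].
apply/bigcupP; exists i => //; rewrite inE iS' andbT.
by apply: contra xS => iS; apply/bigcupP; exists i.
Qed.

(** A word missing from [S'] would have to be covered by its overlaps with [z] other words, that is,
    by at most [z * l < m] elements. This keeps the points of the reduction distinct. *)
Lemma codeunion_inj z (S S' : {set I}) : #|S| = z -> #|S'| = z ->
  (forall i, i \in S -> #|w i| = m) -> z * l < m ->
  codeunion S = codeunion S' -> S = S'.
Proof.
move=> cS cS' wm zlm e; apply/eqP; rewrite eqEcard cS cS' leqnn andbT.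
apply/subsetP => i iS; apply: contraLR zlm => iS'; rewrite -leqNgt -(wm i iS).
have <- : codeunion S' :&: w i = w i.
  by apply/setIidPr; rewrite -e bigcup_sup.
apply: leq_trans (codeunionI_upper _ _) _.
rewrite -cS' -sum_nat_const; apply: leq_sum => j jS'.
by apply: disj_w; apply: contraNneq iS' => <-.
Qed.

(** Take a [y]-set with the largest sum of [a]; swapping [i] for [j] cannot increase it. *)
Lemma exchange_argmax y (a : I -> nat) : y <= #|I| -> exists S : {set I},
  #|S| = y /\ forall i j, i \in S -> j \notin S -> a j <= a i.
Proof.
move=> yI; have /card_gt0P[S0 hS0] : 0 < #|[set S : {set I} | #|S| == y]|.
  by rewrite card_draws bin_gt0.
rewrite inE in hS0.
have [S /eqP cS maxS] := @arg_maxnP _ S0 (fun S : {set I} => #|S| == y)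
  (fun S => \sum_(i in S) a i) hS0.
exists S; split=> // i j iS jS.
have jS' : j \notin S :\ i by rewrite inE negb_and jS orbT.
have cS' : #|j |: S :\ i| == y by rewrite cardsU1 jS' -cS (cardsD1 i S) iS.
have := maxS _ cS'; rewrite big_setU1 //= (big_setD1 i iS) /=.
by rewrite leq_add2r.
Qed.

End Code.

(** Heavy means a share of at least [h * l] with [h = 2 * L], which is [m / K] by the choice of
    [weight_factor]. If [L] elements were heavy, the centre would have at least $2L^2 l - L^2 l$
    ones, while a relevant centre has fewer than $3zm = 6zKLl$; so [L] only has to exceed $6zK$. *)
Definition max_heavy (z K : nat) : nat := (6 * z * K).+1.
Definition weight_factor (z K : nat) : nat := 2 * max_heavy z K * K.

Lemma ltn_max_heavy z K : 0 < K -> z < max_heavy z K.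
Proof. by move=> K_gt0; rewrite /max_heavy ltnS [6 * z]mulnC -mulnA leq_pmulr //
  muln_gt0 K_gt0. Qed.

(** For [K = 4 * z * W] the right-hand side is [m]: the error in a single distance is at most a
    [W]-th of the word weight. *)
Lemma slack_le z W l L : z <= L ->
  W * (2 * z ^ 2 * l + 2 * z * (2 * L) * l) <= 2 * L * (4 * z * W) * l.
Proof.
move=> zL; have -> : 2 * L * (4 * z * W) * l = W * (2 * (2 * z * (2 * L)) * l).
  by lia.
rewrite leq_mul2l -mulnDl leq_mul ?orbT // [leqRHS]mul2n -addnn leq_add2r.
by rewrite -mulnn mulnA leq_mul //; lia.
Qed.

Lemma weight_factor_gt0 z K : 0 < K -> 0 < weight_factor z K.
Proof. by move=> K_gt0; rewrite !muln_gt0 K_gt0. Qed.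

(* The total mass of [C] on [S] is at most [#|C|] up to [codeunionI_lower], so a
   centre [C] cannot be close to the codewords of many elements: [B] collects the
   elements of which [C] contains a fraction of at least [1 / K].  If [T] meets
   [B] in a set [Q] of [y] elements other than the [y] heaviest ones, then some
   element outside [Q] is at least as heavy as some element of [Q], which costs
   as much as losing the latter. *)
Section Center.
Variables (I T : finType) (w : I -> {set T}) (z y l K : nat).
Let L := max_heavy z K.
Let h := 2 * L.
Let m := weight_factor z K * l.
Hypothesis size_w : forall i, #|w i| <= m.
Hypothesis disj_w : forall i j, i != j -> #|w i :&: w j| <= l.
Hypothesis yz : y < z.
Hypothesis zI : z <= #|I|.
Hypothesis l_gt0 : 0 < l.
Hypothesis K_gt0 : 0 < K.
Let U := codeunion w.

Lemma center_witness (C : {set T}) : exists S B : {set I},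
  [/\ #|S| = y, #|B| <= L &
   forall A : {set I}, #|A| = z -> (forall i, i \in A -> #|w i| = m) ->
     y < #|A :&: B| \/
     (z - y).+1 * m <= set_dist (U A) C + (2 * z ^ 2 * l + 2 * z * h * l)
                       + m * (S \subset A)].
Proof.
pose a i := #|w i :&: C|.
have [S [cS maxS]] := exchange_argmax a (leq_trans (ltnW yz) zI).
(* A union of [z] words has at most [z * m] ones, so a centre with [3 * z * m] ones is far from all
   of them, and no element need count as heavy. *)
exists S; have [Cbig|Csmall] := leqP (3 * z * m) #|C|.
  exists set0; rewrite cards0; split=> // A cA wA; right.
  have hU := card_codeunion_upper size_w A; rewrite -/U cA in hU.
  have : #|C| <= set_dist (U A) C + #|U A|.
    by rewrite /set_dist -(cardsID (U A) C); move: (subset_leq_card (subsetIr C (U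
      A))); lia.
  have : (z - y).+1 * m <= 2 * (z * m) by rewrite mulnA leq_mul2r; lia.
  move: Cbig; rewrite -mulnA; lia.
pose B := [set i | h * l <= a i]; exists B.
have ham i : a i <= m.
  by apply: leq_trans (size_w i); apply/subset_leq_card/subsetIl.
have lower (Q : {set I}) : \sum_(i in Q) a i <= #|C| + #|Q| ^ 2 * l.
  apply: leq_trans (codeunionI_lower disj_w Q C) _.
  by rewrite leq_add2r; apply/subset_leq_card/subsetIr.
split=> // [|A cA wA].
  rewrite leqNgt; apply/negP => LB.
  have /card_gt0P[B'] : 0 < #|[set B' : {set I} | B' \subset B & #|B'| == L]|.
    by rewrite cards_draws bin_gt0 ltnW.
  rewrite inE => /andP[B'B /eqP cB'].
  have := lower B'; rewrite cB'.
  have : L * (h * l) <= \sum_(i in B') a i.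
    rewrite -cB' -sum_nat_const; apply: leq_sum => i /(subsetP B'B).
    by rewrite inE.
  have : 3 * z * m + L ^ 2 * l <= L * (h * l).
    rewrite /m /weight_factor /h !expnS expn0 /L /max_heavy; nia.
  lia.
have [|Qy] := ltnP y #|A :&: B|; [by left | right].
set Q := A :&: B in Qy *.
have QA : Q \subset A by apply: subsetIl.
have sumA : \sum_(i in A) a i <= \sum_(i in Q) a i + z * h * l.
  rewrite (big_setID B) /= leq_add2l.
  apply: (@leq_trans (\sum_(i in A :\: B) h * l)).
    by apply: leq_sum => i; rewrite !inE -ltnNge => /andP[/ltnW].
  by rewrite sum_nat_const -mulnA leq_mul2r -cA subset_leq_card ?orbT // subsetDl.
have hU := card_codeunion_lower disj_w wA; rewrite -/U cA in hU.
have hI : #|U A :&: C| <= \sum_(i in A) a i := codeunionI_upper w A C.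
have hD := set_distE (U A) C.
have sumQ : \sum_(i in Q) a i <= #|Q| * m.
  by rewrite -sum_nat_const; apply: leq_sum.
have sq k : k <= z -> k ^ 2 * l <= z ^ 2 * l by move=> kz; rewrite leq_mul2r
  leq_exp2r ?kz ?orbT.
have lowQ := leq_trans (lower Q) (leq_add (leqnn #|C|) (sq #|Q| (leq_trans Qy (ltnW
  yz)))).
(* The sum over [Q] enters twice. One copy is absorbed by [#|C|] through [lowQ], the other is at
   most [#|Q| * m]; this settles the cases of fewer than [y] heavy elements and of [S] inside
   [A]. *)
have key : z * m + #|C| <= set_dist (U A) C + z ^ 2 * l + 2 * (z * h * l)
    + 2 * \sum_(i in Q) a i by lia.
have e1 : 2 * z ^ 2 * l = 2 * (z ^ 2 * l) by rewrite mulnA.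
have e2 : 2 * z * h * l = 2 * (z * h * l) by rewrite !mulnA.
have e3 : z * m = (z - y) * m + y * m by rewrite -mulnDl subnK // ltnW.
rewrite e1 e2 mulSn.
have [/eqP cQ|cQ] := boolP (#|Q| == y); last first.
  have : #|Q| * m + m <= y * m by rewrite addnC -mulSn leq_mul2r; lia.
  lia.
have [SA|SA] := boolP (S \subset A); first by rewrite muln1; rewrite cQ in sumQ; lia.
rewrite muln0 addn0.
have [i iS iA] : exists2 i, i \in S & i \notin A by move/subsetPn: SA.
have [j jQ jS] : exists2 j, j \in Q & j \notin S.
  apply/subsetPn; apply: contra SA => QS.
  suff -> : S = Q by [].
  by apply/esym/eqP; rewrite eqEcard QS cS cQ leqnn.
have iQ : i \notin Q by apply: contra iA; apply: (subsetP QA).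
have aij := maxS i j iS jS.
(* The mass bound applied to [i |: Q] leaves room for an extra [a i] in the first copy. The second
   copy is at most [a j + y.-1 * m], and [a j <= a i] cancels the excess; [y < z] keeps the overlap
   term below $z^2 l$. *)
have := lower (i |: Q); rewrite big_setU1 //= cardsU1 iQ cQ => lowiQ.
have := sq _ yz; rewrite -add1n => sqy.
have sumQj : \sum_(i in Q) a i <= a j + y.-1 * m.
  rewrite (big_setD1 j jQ) /= leq_add2l.
  apply: (@leq_trans (\sum_(i in Q :\ j) m)); first by apply: leq_sum.
  by rewrite sum_nat_const leq_mul2r (cardsD1 j Q) jQ in cQ *; rewrite -cQ orbC leqnn.
have : y.-1 * m + m = y * m by rewrite addnC -mulSn prednK // -cQ; apply/card_gt0P;
  exists j.
lia.
Qed.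

End Center.

(** * The reduction *)

Definition bits_tuple d (v : seq bool) : d.-tuple bool := [tuple nth false v i | i < d].
Arguments bits_tuple : clear implicits.

Lemma val_bits_tuple d v : size v = d -> bits_tuple d v = v :> seq bool.
Proof.
move=> vd; apply: (@eq_from_nth _ false); first by rewrite size_tuple.
move=> i; rewrite size_tuple => id.
by rewrite -[i]/(val (Ordinal id)) -tnth_nth tnth_mktuple.
Qed.

Lemma bitset_tuple d v : bitset d (bits_tuple d v) = bitset d v.
Proof. by apply/setP => j; rewrite !inE -tnth_nth tnth_mktuple. Qed.

Lemma hamming_distE d (a b : d.-tuple bool) :
  hamming_dist a b = set_dist (bitset d a) (bitset d b).
Proof.
rewrite /hamming_dist /set_dist -cardsUI.
have -> : (bitset d a :\: bitset d b) :&: (bitset d b :\: bitset d a) = set0.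
  by apply/setP => j; rewrite !inE; case: (nth _ a j); rewrite ?andbF.
rewrite cards0 addn0; apply: eq_card => j; rewrite !inE !(tnth_nth false).
by case: (nth _ a j); case: (nth _ b j).
Qed.

Definition set_tuple d (C : {set 'I_d}) : d.-tuple bool := [tuple i \in C | i < d].

Lemma bitset_set_tuple d (C : {set 'I_d}) : bitset d (set_tuple C) = C.
Proof. by apply/setP => j; rewrite !inE -tnth_nth tnth_mktuple. Qed.

Definition jc_seqs (I : jc_instance) : seq (seq nat) :=
  [seq [seq nat_of_ord i | i <- enum T] | T : {set 'I_(jc_univ I)} <- jc_sets I].

Definition reduction (c q : nat) (I : jc_instance) : hamming_instance :=
  let E := jc_seqs I in
  @HammingInstance (code_dim c q E)
    [seq bits_tuple _ v | v <- points c q E] (jc_k I).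

Lemma enc_seq_map (A B : Type) (enc : B -> tree) (f : A -> B) s :
  enc_seq enc [seq f x | x <- s] = enc_seq (fun x => enc (f x)) s.
Proof. by elim: s => //= x s ->. Qed.

Lemma enc_jcE I : enc_jc I = Node (enc_nat (jc_univ I))
  (Node (enc_seq (enc_seq enc_nat) (jc_seqs I)) (enc_nat (jc_k I))).
Proof.
rewrite /enc_jc /jc_seqs enc_seq_map; congr (Node _ (Node _ _)).
by elim: (jc_sets I) => //= T s ->; rewrite enc_seq_map.
Qed.

Lemma enc_reductionE c q I : enc_hamming (reduction c q I) =
  Node (enc_seq enc_bits (points c q (jc_seqs I))) (enc_nat (jc_k I)).
Proof.
rewrite /enc_hamming /= enc_seq_map; congr Node.
have : {in points c q (jc_seqs I), forall v, size v = code_dim c q (jc_seqs I)}.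
  by move=> v; rewrite mem_rev => /mapP[T _ ->]; rewrite size_point.
elim: (points _ _ _) => //= v s IH hs.
rewrite val_bits_tuple ?hs ?mem_head // IH // => v' v's.
by apply: hs; rewrite inE v's orbT.
Qed.

Definition alphabet_size (z K : nat) : nat := 2 ^ (2 * z + (weight_factor z K).+1).

Section Correctness.
Variables (z y K : nat).
Hypothesis y_lt_z : y < z.
Hypothesis K_gt0 : 0 < K.
Let c := weight_factor z K.
Let q := alphabet_size z K.

Variable I : jc_instance.
Let n := jc_univ I.
Let E := jc_seqs I.
Let l := code_log E.
Let m := c * l.
Let d := code_dim c q E.
Let M := size (jc_sets I).
Hypothesis uniqE : uniq (jc_sets I).
Hypothesis card_sets : {in jc_sets I, forall T : {set 'I_(jc_univ I)}, #|T| = z}.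
Hypothesis M_gt2 : 2 < M.

Let w (i : 'I_n) : {set 'I_d} := bitset d (lookup (codebook c q E) i).
Let P (T : {set 'I_n}) : d.-tuple bool :=
  bits_tuple d (point (codebook c q E) d [seq nat_of_ord i | i <- enum T]).

Let sizeE : {in E, forall T, size T = z}.
Proof. by move=> _ /mapP[T TE ->]; rewrite size_map -cardE card_sets. Qed.

Let c_gt0 : 0 < c. Proof. exact: weight_factor_gt0. Qed.
Let z_gt0 : 0 < z. Proof. by apply: leq_ltn_trans y_lt_z. Qed.
Let E_gt2 : 2 < size E. Proof. by rewrite size_map. Qed.
Let l_gt0 : 0 < l. Proof. exact: (code_log_gt0 E_gt2). Qed.

Let book := codebookP (erefl q) c_gt0 z_gt0 E_gt2 sizeE.

Let size_lookup i : size (lookup (codebook c q E) i) <= d.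
Proof.
case: book => b0 b1 _; have [iE|iE] := boolP (i \in flat E).
  by case: (b1 i iE) => ->.
by rewrite (b0 i iE).
Qed.

Let card_w i : #|w i| = agree (lookup (codebook c q E) i) (lookup (codebook c q E) i).
Proof. by rewrite -(card_bitsetI _ (size_lookup i)) setIid. Qed.

Let size_w i : #|w i| <= m.
Proof.
rewrite card_w; case: book => b0 b1 _; have [iE|iE] := boolP ((i : nat) \in flat E).
  by case: (b1 i iE) => _ ->.
by rewrite (b0 i iE).
Qed.

Let disj_w i j : i != j -> #|w i :&: w j| <= l.
Proof.
by move=> ij; rewrite card_bitsetI //; case: book => _ _; apply.
Qed.

Let full_w T i : T \in jc_sets I -> i \in T -> #|w i| = m.
Proof.
move=> TE iT; rewrite card_w; case: book => _ b1 _.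
have [|_ //] := b1 i; rewrite mem_flat; apply/hasP.
exists [seq nat_of_ord i | i <- enum T]; first by apply: map_f.
by rewrite mem_map ?mem_enum //; apply: val_inj.
Qed.

Let bitset_P T : bitset d (P T) = codeunion w T.
Proof.
rewrite bitset_tuple bitset_point //; apply/setP => j; rewrite inE.
apply/hasP/bigcupP => [[_ /mapP[i iT ->] jw]|[i iT jw]].
  by exists i => //; rewrite -mem_enum.
by exists (i : nat) => //; apply/mapP; exists i; rewrite ?mem_enum.
Qed.

Lemma reduction_points : hm_points (reduction c q I) = rev [seq P T | T <- jc_sets I].
Proof. by rewrite /= /points map_rev -!map_comp. Qed.

Lemma size_reduction_points : size (hm_points (reduction c q I)) = M.
Proof. by rewrite reduction_points size_rev size_map. Qed.

Lemma uniq_reduction_points : uniq (hm_points (reduction c q I)).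
Proof.
rewrite reduction_points rev_uniq map_inj_in_uniq // => T T' TE T'E e.
have := congr1 (fun t : d.-tuple bool => bitset d t) e.
rewrite !bitset_P; apply: (@codeunion_inj _ _ w m l _ z); rewrite ?card_sets //.
  by move=> i; apply: full_w.
rewrite /m ltn_pmul2r // /c /weight_factor -mulnA mulnCA.
by apply: leq_trans (ltn_max_heavy z K_gt0) _; rewrite leq_pmulr // muln_gt0.
Qed.

Lemma reduction_cost (sigma : d.-tuple bool -> d.-tuple bool) :
  assignment_cost (I := reduction c q I) sigma =
  \sum_(T <- jc_sets I) set_dist (codeunion w T) (bitset d (sigma (P T))).
Proof.
rewrite /assignment_cost reduction_points (perm_big _ (permEl (perm_rev _))) /= big_map.
by apply: eq_bigr => T _; rewrite hamming_distE bitset_P.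
Qed.

Lemma reduction_complete : 0 < jc_k I -> jc_complete y I ->
  exists (C : 'I_(hm_k (reduction c q I)) -> (hm_dim (reduction c q I)).-tuple bool)
    (sigma : (hm_dim (reduction c q I)).-tuple bool -> (hm_dim (reduction c q
      I)).-tuple bool),
    assignment C sigma /\ assignment_cost sigma <= M * ((z - y) * m).
Proof.
move=> k_gt0 [S [cS hS]].
pose C (i : 'I_(jc_k I)) : d.-tuple bool := set_tuple (codeunion w (S i)).
pose near a := [arg min_(i < Ordinal k_gt0) hamming_dist a (C i)].
exists C, (fun a => C (near a)); split; first by move=> a _; exists (near a).
rewrite reduction_cost /M -sum1_size big_distrl /= big_seq [leqRHS]big_seq.
apply: leq_sum => T TE; rewrite mul1n -bitset_P -(hamming_distE (P T) (C (near (P T)))).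
have [i iT] := hS T TE.
rewrite /near; case: arg_minnP => // j _ /(_ i isT) => le_ji.
apply: leq_trans le_ji _; rewrite hamming_distE bitset_P bitset_set_tuple.
by rewrite -(card_sets TE) -(cS i) codeunion_dist_subset.
Qed.

(** The alternative of [center_witness] is summed over the collection, each set being compared with
    the centre that serves it. A set with too many heavy elements gets no distance bound: its whole
    contribution is charged to the last term. *)
Lemma reduction_sound
    (C : 'I_(hm_k (reduction c q I)) -> (hm_dim (reduction c q I)).-tuple bool)
    (sigma : (hm_dim (reduction c q I)).-tuple bool -> (hm_dim (reduction c q
      I)).-tuple bool) :
  assignment C sigma ->
  exists S : 'I_(jc_k I) -> {set 'I_(jc_univ I)},
    (forall i, #|S i| = y) /\
    M * ((z - y).+1 * m) <= assignment_cost sigma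
      + M * (2 * z ^ 2 * l + 2 * z * (2 * max_heavy z K) * l)
      + m * count (fun T : {set 'I_(jc_univ I)} => [exists i, S i \subset T])
        (jc_sets I)
      + (z - y).+1 * m * (jc_k I * (2 ^ max_heavy z K * n ^ (z - y - 1))).
Proof.
move=> hsigma.
have zn : z <= #|'I_n|.
  have [T TE] : exists T, T \in jc_sets I.
    by move: M_gt2; rewrite /M; case: (jc_sets I) => // T s _; exists T; apply:
      mem_head.
  by rewrite -(card_sets TE) max_card.
have center (i : 'I_(jc_k I)) := center_witness (w := w) (K := K)
  size_w disj_w y_lt_z zn l_gt0 K_gt0 (bitset d (C i)).
have [S hS] := fin_all_exists center.
have [B hB] := fin_all_exists hS.
exists S; split=> [i|]; first by case: (hB i).
pose heavy T := [exists i, y < #|T :&: B i|].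
have heavy_count : count heavy (jc_sets I) <= jc_k I * (2 ^ max_heavy z K * n ^ (z
  - y - 1)).
  rewrite -size_filter -(card_uniqP (filter_uniq heavy uniqE)).
  apply: (@leq_trans #|\bigcup_(i in [set: 'I_(jc_k I)])
      [set T : {set 'I_n} | (#|T| == z) && (y < #|T :&: B i|)]|).
    apply/subset_leq_card/subsetP => T; rewrite mem_filter => /andP[/existsP[i hi] TE].
    by apply/bigcupP; exists i; rewrite !inE // card_sets // eqxx.
  apply: leq_trans (leq_card_bigcup _ _) _.
  apply: (@leq_trans (\sum_(i in [set: 'I_(jc_k I)]) 2 ^ max_heavy z K * n ^ (z - y
    - 1))); last first.
    by rewrite sum_nat_const cardsT card_ord.
  apply: leq_sum => i _; apply: leq_trans (card_heavy _ _ _) _.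
  by rewrite card_ord leq_mul // leq_pexp2l //; case: (hB i).
have split_sum : M * ((z - y).+1 * m) <= assignment_cost (I := reduction c q I) sigma
    + M * (2 * z ^ 2 * l + 2 * z * (2 * max_heavy z K) * l)
    + m * count (fun T : {set 'I_(jc_univ I)} => [exists i, S i \subset T]) (jc_sets I)
    + (z - y).+1 * m * count heavy (jc_sets I).
  rewrite reduction_cost -!sum1_count !big_distrr /= ![\sum_(_ <- _ | _)
    _]big_mkcond /=.
  rewrite /M -sum1_size !big_distrl -!big_split /= big_seq [leqRHS]big_seq.
  apply: leq_sum => T TE; rewrite !mul1n !muln1.
  have PT : P T \in hm_points (reduction c q I).
    by rewrite reduction_points mem_rev map_f.
  have [i ->] := hsigma _ PT; have [_ _ /(_ T (card_sets TE))] := hB i.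
  case=> [j jT|hi|hi]; first exact: full_w TE jT.
    by have -> : heavy T; [apply/existsP; exists i | rewrite leq_addl].
  apply: leq_trans hi _; rewrite -[leqLHS]addn0 leq_add // leq_add2l.
  case: ifPn => [_|/existsPn/(_ i)/negbTE ->]; last by rewrite muln0.
  by rewrite -[leqRHS]muln1 leq_mul2l leq_b1 orbT.
by apply: leq_trans split_sum _; rewrite leq_add2l leq_mul2l heavy_count orbT.
Qed.

End Correctness.

(** * Small instances *)

Fixpoint tree_eqb (s t : tree) : bool :=
  match s, t with
  | Leaf, Leaf => true
  | Node s1 s2, Node t1 t2 => tree_eqb s1 t1 && tree_eqb s2 t2
  | _, _ => false
  end.

Lemma tree_eqP : Equality.axiom tree_eqb.
Proof.
elim=> [|s1 IH1 s2 IH2] [|t1 t2] /=; try by constructor.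
by apply: (iffP andP) => [[/IH1 -> /IH2 ->]|[/IH1 -> /IH2 ->]].
Qed.

HB.instance Definition _ := hasDecEq.Build tree tree_eqP.

Lemma computes_eq_const X (u v : X -> tree) t : computes u v ->
  computes u (fun x => enc_bool (v x == t)).
Proof.
have uT b := computes_const u (enc_bool b).
elim: t v => [|l IHl r IHr] v uv.
  by apply: computes_ext (computes_if uv (uT false) (uT true)) => x; case: (v x).
have uvl := computes_trans uv (@computes_ev _ (ELeft (EVar 0)) v _ (fun=> erefl)).
have uvr := computes_trans uv (@computes_ev _ (ERight (EVar 0)) v _ (fun=> erefl)).
apply: computes_ext (computes_if uv
  (computes_if_bool (IHl _ uvl) (IHr _ uvr) (uT false)) (uT false)) => x.
rewrite /ev /=; case: (v x) => [|l' r'] //=.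
have -> : (Node l' r' == Node l r) = (l' == l) && (r' == r) by [].
by case: (l' == l).
Qed.

Lemma computes_mem X (u v : X -> tree) (F : seq tree) : computes u v ->
  computes u (fun x => enc_bool (v x \in F)).
Proof.
move=> uv; elim: F => [|t F IH]; first exact: (computes_const u Leaf).
apply: computes_ext (computes_if_bool (computes_eq_const t uv)
  (computes_const u (enc_bool true)) IH) => x.
by rewrite inE; case: eqP.
Qed.

Lemma polytime_computes (A B D : Type) (encA : A -> tree) (encB : B -> tree)
    (encD : D -> tree) (f : A -> B) (g : A -> D) :
  polytime encA encB f ->
  computes (fun a => encB (f a)) (fun a => encD (g a)) ->
  polytime encA encD g.
Proof.
move=> [c [m hc]] [C [p hC]].
have tA a : 0 < tsize (encA a) by apply: tsize_gt0.
have pid : size_bounded encA (fun a => tsize (encA a)) := poly_bounded_id _.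
have pm : size_bounded encA (fun a => m * tsize (encA a) ^ m) by exists m.
have [r hr] : size_bounded encA (fun a => m * tsize (encA a) ^ m +
    p * (tsize (encA a) + m * tsize (encA a) ^ m) ^ p).
  by do ![exact: size_bounded_cst || exact: pid || exact: pm ||
    apply: poly_bounded_add || apply: poly_bounded_mul || apply: poly_bounded_exp].
exists (Seq c (C 0)), r => a; have [s [t [hs s0 ht]]] := hc a.
have [s' [t' [hs' s0' _ ht']]] := hC 0 a s s0.
exists s', (t + t'); split=> //; first exact: ExecSeq hs hs'.
apply: leq_trans (hr a); rewrite leq_add //; apply: leq_trans ht' _.
rewrite leq_mul // leq_exp2rW // -s0.
by apply: leq_trans (exec_size hs 0) _; rewrite leq_add.
Qed.

Lemma enc_nat_inj : injective enc_nat.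
Proof. by elim=> [|m IH] [|n] //= [/IH ->]. Qed.

Lemma enc_seq_inj (A : Type) (enc : A -> tree) : injective enc -> injective
  (enc_seq enc).
Proof. by move=> inj; elim=> [|x s IH] [|y t] //= [/inj -> /IH ->]. Qed.

Lemma enc_jc_inj : injective enc_jc.
Proof.
move=> [n E k] [n' E' k']; rewrite !enc_jcE /= => -[/enc_nat_inj en + /enc_nat_inj ->].
case: n' / en E' => E' /(enc_seq_inj (enc_seq_inj enc_nat_inj)); rewrite /jc_seqs /=.
move/inj_map => -> // T T' e; apply/setP => i.
by rewrite -[LHS]mem_enum -[RHS]mem_enum -[LHS](mem_map (@ord_inj n)) e (mem_map
  (@ord_inj n)).
Qed.

Lemma uniq_seqs (T : finType) : exists l : seq (seq T), forall s, uniq s -> s \in l.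
Proof.
exists (flatten [seq [seq tval t | t <- enum {: k.-tuple T}] | k <- iota 0 #|T|.+1]).
move=> s us; apply/flatten_mapP; exists (size s).
  by rewrite mem_iota /= ltnS -(card_uniqP us) max_card.
by apply/mapP; exists (in_tuple s); rewrite ?mem_enum.
Qed.

(** Duplicate-freeness leaves finitely many collections over a bounded universe. The table exists
    classically for any [Q], and injectivity of the encoding lets the program consult it by
    comparing trees. *)
Lemma small_table (N K : nat) (Q : jc_instance -> Prop) : exists F : seq tree,
  forall I, jc_univ I < N -> jc_k I < K -> uniq (jc_sets I) ->
    (enc_jc I \in F) <-> Q I.
Proof.
have [F hF] : exists F : seq tree, forall I, jc_univ I < N -> jc_k I < K ->
    uniq (jc_sets I) -> enc_jc I \in F.
  elim: N => [|n [F hF]]; first by exists [::].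
  have [l hl] := uniq_seqs {set 'I_n}.
  exists (F ++ [seq enc_jc (@JCInstance n E k) | E <- l, k <- iota 0 K]).
  move=> I; rewrite ltnS leq_eqVlt mem_cat => /orP[/eqP eI|ltI] kI uI; last by
    rewrite hF.
  case: I eI kI uI => n' E k /= en; subst n' => kK uE.
  by apply/orP; right; apply: allpairs_f; rewrite ?hl // mem_iota.
exists [seq t <- F | `[< exists2 I, enc_jc I = t & Q I >]] => I nI kI uI.
rewrite mem_filter hF // andbT; split=> [/asboolP[I' /enc_jc_inj -> //]|QI].
by apply/asboolP; exists I.
Qed.

Lemma large_k_complete z y I : y <= z ->
  {in jc_sets I, forall T : {set 'I_(jc_univ I)}, #|T| = z} ->
  0 < size (jc_sets I) -> 2 ^ jc_univ I <= jc_k I -> jc_complete y I.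
Proof.
move=> yz hz; case e: (jc_sets I) => [|T0 E] // _ hk.
have sub (T : {set 'I_(jc_univ I)}) : T \in jc_sets I ->
    exists2 S : {set 'I_(jc_univ I)}, S \subset T & #|S| = y.
  move=> TE; have /card_gt0P[S] : 0 < #|[set S : {set 'I_(jc_univ I)} | S \subset T
    & #|S| == y]|.
    by rewrite cards_draws bin_gt0 (hz _ TE).
  by rewrite inE => /andP[ST /eqP cS]; exists S.
have [|S0 _ cS0] := sub T0; first by rewrite e mem_head.
pose s := enum [set S : {set 'I_(jc_univ I)} | #|S| == y].
have sk : size s <= jc_k I.
  rewrite -cardE; apply: leq_trans hk.
  have := card_powerset [set: 'I_(jc_univ I)]; rewrite cardsT card_ord => <-.
  by apply/subset_leq_card/subsetP => S _; rewrite inE subsetT.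
(* All [y]-sets are listed; the surplus indices get [S0], because each of the [jc_k I] sets must
   have [y] elements. *)
exists (fun i : 'I_(jc_k I) => nth S0 s i); split=> [i|T TE].
  have [lt_i|le_i] := ltnP i (size s); last by rewrite nth_default.
  by have := mem_nth S0 lt_i; rewrite mem_enum inE => /eqP.
have [S ST cS] := sub T TE.
have Ss : S \in s by rewrite mem_enum inE cS.
have lt_i : index S s < jc_k I by apply: leq_trans sk; rewrite index_mem.
by exists (Ordinal lt_i); rewrite /= nth_index.
Qed.

(** Hence a table that records completeness alone also answers the sound instances correctly. *)
Lemma not_complete_sound (R : realType) (alpha : R) y I :
  (alpha < 1)%R -> 0 < size (jc_sets I) -> jc_sound alpha y I -> ~ jc_complete y I.
Proof.
move=> alpha1 E_gt0 hsound [S [cS hS]].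
have := hsound S cS.
have -> : count (fun T : {set 'I_(jc_univ I)} => [exists i, S i \subset T])
  (jc_sets I) = size (jc_sets I).
  by apply/eqP; rewrite -all_count; apply/allP => T /hS [i iT]; apply/existsP; exists i.
rewrite leNgt; case/negP.
by rewrite -subr_gt0 -{1}[X in (X - _)%R]mul1r -mulrBl mulr_gt0 ?subr_gt0 // ltr0n.
Qed.

(* The points [0^r] and [1^r]: with one centre the cost is exactly [r]. *)
Definition antipodal (r k : nat) : hamming_instance :=
  @HammingInstance r [:: bits_tuple r (nseq r false); bits_tuple r (nseq r true)] k.

Lemma bitset_nseq r b : bitset r (bits_tuple r (nseq r b)) = if b then setT else set0.
Proof.
rewrite bitset_tuple; apply/setP => i; rewrite inE nth_nseq ltn_ord.
by case: b; rewrite !inE.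
Qed.

Lemma uniq_antipodal r k : 0 < r -> uniq (hm_points (antipodal r k)).
Proof.
move=> r_gt0; rewrite /= andbT inE; apply/eqP => e.
have := congr1 (fun t : r.-tuple bool => bitset r t) e; rewrite /= !bitset_nseq.
by move/setP/(_ (Ordinal r_gt0)); rewrite !inE.
Qed.

Lemma antipodal_cost1 r C sigma : assignment (I := antipodal r 1) C sigma ->
  assignment_cost (I := antipodal r 1) sigma = r.
Proof.
move=> h; rewrite /assignment_cost /= !big_cons big_nil addn0.
have [|i0 ->] := h (bits_tuple r (nseq r false)); first by rewrite mem_head.
have [|i1 ->] := h (bits_tuple r (nseq r true)); first by rewrite !inE eqxx orbT.
rewrite (ord1 i0) (ord1 i1) !hamming_distE !bitset_nseq /set_dist.
by rewrite set0D setD0 setTD setDT !cards0 add0n addn0 cardsC card_ord.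
Qed.

Lemma antipodal_cost2 r : exists C sigma,
  assignment (I := antipodal r 2) C sigma /\
  assignment_cost (I := antipodal r 2) sigma = 0.
Proof.
exists (fun i => bits_tuple r (nseq r (i == 1 :> nat))), id; split.
  by move=> a; rewrite !inE => /orP[] /eqP ->; [exists ord0 | exists (Ordinal (isT
    : 1 < 2))].
rewrite /assignment_cost /= !big_cons big_nil !hamming_distE /set_dist.
by rewrite !setDv !cards0.
Qed.

(** * Real estimates and choice of the constants *)

Local Open Scope ring_scope.

Lemma rlog_ln (R : realType) (M : nat) : (0 < M)%N ->
  ((rlog M)%:R : R) <= ln (M%:R : R) / ln 2 <= (rlog M)%:R + 1.
Proof.
move=> M_gt0; have ln2_gt0 : 0 < (ln 2 : R) by rewrite ln_gt0 // ltr1n.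
have lnp l : ln ((2 ^ l)%N%:R : R) = l%:R * ln 2.
  by rewrite natrX lnXn ?ltr0n // mulr_natl.
have pos k : (0 < k)%N -> (k%:R : R) \in Num.pos by move=> k0; rewrite posrE ltr0n.
have /andP[lo hi] := rlogP M_gt0.
rewrite ler_pdivlMr // ler_pdivrMr // natr1 -!lnp.
by rewrite !ler_ln ?pos ?expn_gt0 // !ler_nat lo hi.
Qed.

(** The threshold involves the true logarithm [X], the code its rounding [l]. Replacing [X] by
    [l + 1] costs at most [B], which half of [l * e] covers; for a negative factor [X] is instead
    replaced by [l]. *)
Lemma ler_log_loss (R : realFieldType) (B e e' X l : R) :
  0 <= l -> l <= X <= l + 1 -> 0 < e -> e <= e' -> 2 * B <= l * e ->
  (B - e') * X <= (B - e / 2) * l.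
Proof.
move=> l_ge0 /andP[lX Xl] e_gt0 ee' Bl.
have [hB|hB] := leP 0 (B - e').
  have h1 : (B - e') * X <= (B - e') * (l + 1) by rewrite ler_wpM2l.
  have h2 : (B - e') * (l + 1) <= (B - e) * (l + 1).
    by rewrite ler_wpM2r ?addr_ge0 // lerB.
  have -> : (B - e / 2) * l = (B - e) * l + l * e / 2 by field.
  by rewrite !mulrDr !mulr1 in h1 h2 *; lra.
have h1 : (B - e') * X <= (B - e') * l by rewrite ler_nM2l.
by apply: le_trans h1 _; rewrite ler_wpM2r //; lra.
Qed.

(* [s] is the slack of a single distance, [cnt] the number of covered sets and
   [H] the number of sets close to some centre because of many heavy elements. *)
Lemma sound_cost (R : realFieldType) (alpha e : R) (d M m cost s cnt H W : nat) :
  (0 < W)%N -> 4 <= W%:R * e ->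
  (M * (d.+1 * m) <= cost + M * s + m * cnt + d.+1 * m * H)%N ->
  (W * s <= m)%N -> (W * (d.+1 * H) <= M)%N -> cnt%:R <= alpha * M%:R ->
  M%:R * m%:R * (d%:R + 1 - alpha - e / 2) <= cost%:R.
Proof.
move=> W_gt0 We; rewrite -!(ler_nat R) -addn1 !(natrD, natrM) => hcost hs hH hcnt.
have W0 : 0 < W%:R :> R by rewrite ltr0n.
have We' x : 0 <= x -> x / W%:R <= x * e / 4.
  by move=> x0; rewrite ler_pdivrMr // mulrAC -!mulrA ler_peMr //; lra.
have s_le : M%:R * s%:R <= M%:R * (m%:R * e / 4).
  by rewrite ler_wpM2l // (le_trans _ (We' _ _)) // ler_pdivlMr // mulrC.
have H_le : m%:R * ((d%:R + 1) * H%:R) <= m%:R * (M%:R * e / 4).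
  by rewrite ler_wpM2l // (le_trans _ (We' _ _)) // ler_pdivlMr // mulrC.
have c_le : m%:R * cnt%:R <= m%:R * (alpha * M%:R) by rewrite ler_wpM2l.
have e1 : (d%:R + 1) * m%:R * H%:R = m%:R * ((d%:R + 1) * H%:R) :> R by ring.
have -> : M%:R * m%:R * (d%:R + 1 - alpha - e / 2) =
  M%:R * ((d%:R + 1) * m%:R) - m%:R * (alpha * M%:R)
    - M%:R * (m%:R * e / 4) - m%:R * (M%:R * e / 4) by field.
by rewrite e1 in hcost; lra.
Qed.

Theorem theorem3p20 (R : realType) (z y : nat) (alpha : R)
    (hy : (1 <= y)%N) (hyz : (y < z)%N) (halpha0 : 0 <= alpha) (halpha1 : alpha < 1)
    (hJC : johnson_coverage_star_NP_hard alpha z y)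
    (eps : R) (heps : 0 < eps) :
  exists rho : R, 0 < rho /\
    exists b : R, 0 < b /\
      NP_hard enc_hamming
        (fun I => hamming_promise b I /\
           hamming_cost_at_most (rho * n_log_n R I) I)
        (fun I => hamming_promise b I /\
           hamming_cost_at_least
             ((1 + (1 - alpha) / (z - y)%:R - eps) * (rho * n_log_n R I)) I).
Proof.
have [g [g_infty hard]] := hJC.
pose W := (Num.bound (4 / eps)).+1; pose K := (4 * z * W)%N.
have We : 4 <= W%:R * eps.
  rewrite -ler_pdivrMr // ltW // (lt_le_trans (archi_boundP _)) ?ler_nat //.
  by rewrite divr_ge0 // ltW.
have W_gt0 : (0 < W)%N by [].
have z_gt0 : (0 < z)%N by apply: leq_ltn_trans hyz.
have K_gt0 : (0 < K)%N by rewrite !muln_gt0 z_gt0.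
pose L := max_heavy z K; pose c := weight_factor z K; pose q := alphabet_size z K.
have c_gt0 : (0 < c)%N by apply: weight_factor_gt0.
have q_gt0 : (0 < q)%N by rewrite /q /alphabet_size expn_gt0.
(* The first summand makes the sets with too many heavy elements at most a [W]-th of the collection,
   even after the factor [(z - y).+1]. The second forces [l >= (z + 1) * W], as the rounding loss
   requires. The third gives more than two sets. *)
have [N0 hN0] := g_infty ((z + 1) * 2 ^ L * W + 2 ^ ((z + 1) * W + 1) + 3)%N.
(* The successor keeps the universe of a large instance nonempty, so that [ke] below is positive. *)
pose N := N0.+1.
have ln2_gt0 : 0 < (ln 2 : R) by rewrite ln_gt0 // ltr1n.
pose A : R := (z - y)%:R.
have A_ge1 : 1 <= A by rewrite /A (ler_nat R 1) subn_gt0.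
have A_gt0 : 0 < A := lt_le_trans ltr01 A_ge1.
(* In the complete case a point costs at most $(z-y)\,c\,l$ with $l \le \ln M / \ln 2$. *)
pose rho : R := A * c%:R / ln 2.
pose F : R := 1 + (1 - alpha) / (z - y)%:R - eps.
(* For two points, [n_log_n] is [2 * ln 2]; the dimension [r.+1] lifts the cost of the one-centre
   antipodal instance above the soundness threshold. *)
have [r hr] : exists r : nat, F * (rho * (2 * ln 2)) <= r.+1%:R.
  exists (Num.bound (`|F * (rho * (2 * ln 2))|)); apply: le_trans (ler_norm _) _.
  by apply: ltW; apply: lt_le_trans (archi_boundP _) _; rewrite ?ler_nat.
(* The summand [q * c] serves the dimension of the code, [r.+1] that of the antipodal instances,
   where $\ln n = \ln 2$. *)
pose b : R := (q * c + r.+1)%:R / ln 2.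
have c0 : 0 < c%:R :> R by rewrite ltr0n.
have rho_gt0 : 0 < rho by rewrite divr_gt0 // mulr_gt0.
exists rho; split=> //.
exists b; split; first by rewrite divr_gt0 // ltr0n addnS.
have anti k : (0 < k)%N -> hamming_promise b (antipodal r.+1 k).
  move=> k_gt0; split=> //; first exact: uniq_antipodal.
  by rewrite /= /b divfK ?gt_eqF // ler_nat leq_addl.
have yesP : hamming_promise b (antipodal r.+1 2) /\
    hamming_cost_at_most (rho * n_log_n R (antipodal r.+1 2)) (antipodal r.+1 2).
  split; first exact: anti.
  have [C [s [hs cost0]]] := antipodal_cost2 r.+1.
  exists C, s; split; rewrite // cost0 /n_log_n /=.
  by apply: mulr_ge0; [exact: ltW | apply: mulr_ge0; rewrite // ltW].
have noP : hamming_promise b (antipodal r.+1 1) /\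
    hamming_cost_at_least (F * (rho * n_log_n R (antipodal r.+1 1))) (antipodal r.+1 1).
  split; first exact: anti.
  by move=> C s hs; rewrite (antipodal_cost1 hs).
move=> Lang /hard[f [fpoly fyes fno]].
have [T hT] := small_table N (2 ^ N) (jc_complete y).
pose G (I : jc_instance) : hamming_instance :=
  if (jc_univ I < N)%N then
    if (jc_k I < 2 ^ N)%N then
      if enc_jc I \in T then antipodal r.+1 2 else antipodal r.+1 1
    else antipodal r.+1 2
  else reduction c q I.
have Gsmall I : jc_promise z y g I -> (jc_univ I < N)%N ->
    (jc_complete y I -> G I = antipodal r.+1 2) /\
    (~ jc_complete y I -> G I = antipodal r.+1 1).
  move=> [uI cI I_gt0 k_gt0 _] IN; rewrite /G IN; case: ifP => kN.
    have := hT I IN kN uI; case: (enc_jc I \in T) => [] [h1 h2]; split=> //.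
    + by case; apply: h1.
    + by move/h2.
  split=> // -[]; apply: large_k_complete cI I_gt0 _; first exact: ltnW.
  by apply: leq_trans (_ : 2 ^ N <= _)%N; [rewrite leq_exp2l // ltnW | rewrite
    leqNgt kN].
have Glarge I : jc_promise z y g I -> ~~ (jc_univ I < N)%N ->
    [/\ G I = reduction c q I, hamming_promise b (reduction c q I),
        jc_complete y I ->
          hamming_cost_at_most (rho * n_log_n R (reduction c q I)) (reduction c q I) &
        jc_sound alpha y I ->
          hamming_cost_at_least (F * (rho * n_log_n R (reduction c q I)))
            (reduction c q I)].
  move=> [uI cI I_gt0 k_gt0 gI] IN.
  set M := size (jc_sets I) in I_gt0 gI; set l := code_log (jc_seqs I).
  pose ke := (jc_k I * jc_univ I ^ (z - y - 1))%N.
  rewrite -leqNgt in IN.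
  have ke_gt0 : (0 < ke)%N by rewrite muln_gt0 k_gt0 expn_gt0 (leq_trans _ IN).
  have gM := leq_trans (leq_mul (hN0 _ (leq_trans (leqnSn _) IN)) (leqnn ke)) gI.
  have keM : ((z + 1) * 2 ^ L * W * ke <= M)%N.
    by apply: leq_trans gM; rewrite leq_mul2r -addnA leq_addr orbT.
  have M_large : (2 ^ ((z + 1) * W + 1) + 3 <= M)%N.
    apply: leq_trans gM; apply: leq_trans (leq_pmulr _ ke_gt0).
    by rewrite -addnA leq_addl.
  have M_gt2 : (2 < M)%N by apply: leq_trans M_large; rewrite leq_addl.
  have M_gt0 : (0 < M)%N by apply: leq_trans M_gt2.
  have el : l = rlog M by rewrite /l /code_log size_map.
  have l_large : ((z + 1) * W <= l)%N.
    have /andP[_ hi] := rlogP M_gt0; rewrite -ltnS -addn1 -(@leq_exp2l 2) // el.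
    by apply: leq_trans hi; apply: leq_trans M_large; rewrite leq_addr.
  pose X : R := ln (M%:R) / ln 2; have lX := rlog_ln R M_gt0; rewrite -/X -el in lX.
  have /andP[l_le_X X_le_l] := lX.
  have lnM : ln (M%:R : R) = X * ln 2 by rewrite divfK ?gt_eqF.
  have nlogn : n_log_n R (reduction c q I) = M%:R * (X * ln 2).
    by rewrite /n_log_n size_reduction_points -/M lnM.
  split; first by rewrite /G ltnNge IN.
  - split=> //; first exact: (uniq_reduction_points hyz).
      by rewrite size_reduction_points -/M ltnW.
    rewrite size_reduction_points -/M lnM /b [X * _]mulrC mulrA divfK ?gt_eqF //.
    rewrite /= /code_dim -/l mulnA natrM ler_pM ?ler0n //.
    by rewrite ler_nat leq_addr.
  - move=> /(reduction_complete hyz K_gt0 cI M_gt2 k_gt0)[C [s [hs cost]]].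
    exists C, s; split=> //; rewrite nlogn.
    apply: (@le_trans _ _ ((M * ((z - y) * (c * l)))%N%:R)); first by rewrite ler_nat.
    rewrite (natrM _ M) (natrM _ (z - y)) (natrM _ c) -/A /rho.
    have -> : A * c%:R / ln 2 * (M%:R * (X * ln 2)) = M%:R * (A * (c%:R * X)).
      by field; rewrite gt_eqF.
    by rewrite !ler_wpM2l ?ler0n ?(ltW A_gt0).
  - move=> hsound C s hs; rewrite nlogn.
    have [S [cS cost]] := reduction_sound hyz K_gt0 uI cI M_gt2 hs.
    have := hsound S cS; rewrite -/M; set cnt := count _ _ => hcnt.
    set tot := assignment_cost _ in cost *.
    have -> : F * (rho * (M%:R * (X * ln 2))) =
        (A + 1 - alpha - eps * A) * X * (M%:R * c%:R).
      by rewrite /F /rho -/A; field; rewrite !gt_eqF.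
    (* Both [A] and 1 are at most [z + 1], and [l * eps >= (z + 1) * W * eps >= 4 * (z + 1)]. *)
    have l_eps : 2 * (A + 1 - alpha) <= l%:R * eps.
      have h1 : ((z + 1) * W)%N%:R <= l%:R :> R by rewrite ler_nat.
      have h2 : ((z + 1) * W)%N%:R * eps <= l%:R * eps by rewrite ler_wpM2r // ltW.
      have h3 : (z + 1)%N%:R * 4 <= (z + 1)%N%:R * (W%:R * eps) by rewrite ler_wpM2l.
      have h4 : A <= (z + 1)%N%:R by rewrite ler_nat addn1 ltnW // ltnS leq_subr.
      have h5 : 1 <= (z + 1)%N%:R :> R by rewrite (ler_nat R 1) addn1.
      rewrite natrM -mulrA in h2; move: h2 h3 h4 h5 halpha0; clear; lra.
    have eps_A : eps <= eps * A by rewrite ler_peMr // ltW.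
    have loss := ler_log_loss (ler0n R l) lX heps eps_A l_eps.
    apply: le_trans (ler_wpM2r (mulr_ge0 (ler0n R M) (ltW c0)) loss) _.
    have -> : (A + 1 - alpha - eps / 2) * l%:R * (M%:R * c%:R) =
      M%:R * (c * l)%N%:R * (A + 1 - alpha - eps / 2) by rewrite natrM; ring.
    pose slack := (2 * z ^ 2 * l + 2 * z * (2 * L) * l)%N.
    pose H := (jc_k I * (2 ^ L * jc_univ I ^ (z - y - 1)))%N.
    apply: (@sound_cost _ _ _ _ _ _ _ slack cnt H W) => //.
    + exact: slack_le (ltnW (ltn_max_heavy z K_gt0)).
    + apply: leq_trans keM.
      rewrite /H /ke; set e := (_ ^ (z - y - 1))%N.
      have -> : (W * ((z - y).+1 * (jc_k I * (2 ^ L * e))) =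
        (z - y).+1 * (2 ^ L * W * (jc_k I * e)))%N by ring.
      by rewrite -!mulnA leq_mul2r addn1 ltnS leq_subr orbT.
exists (fun x => G (f x)); split.
- apply: polytime_computes fpoly _; pose u x := enc_jc (f x).
  have uk : computes u (fun x => enc_nat (jc_k (f x))).
    apply: (@computes_ev _ (ERight (ERight (EVar 0)))) => x.
    by rewrite /u enc_jcE.
  have un : computes u (fun x => enc_nat (jc_univ (f x))).
    by apply: (@computes_ev _ (ELeft (EVar 0))) => x; rewrite /u enc_jcE.
  have uE : computes u (fun x => enc_seq (enc_seq enc_nat) (jc_seqs (f x))).
    by apply: (@computes_ev _ (ELeft (ERight (EVar 0)))) => x; rewrite /u enc_jcE.
  have uY := computes_const u (enc_hamming (antipodal r.+1 2)).
  have uN := computes_const u (enc_hamming (antipodal r.+1 1)).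
  apply: computes_ext (computes_if (computes_subn (computes_const u (enc_nat N)) un)
    (computes_if (computes_subn (computes_const u (enc_nat (2 ^ N))) uk)
      (computes_if_bool (computes_mem T (computes_id u)) uY uN) uY)
    (computes_pair (computes_points c q_gt0 uE) uk)) => x.
  rewrite !is_node_enc_nat !subn_gt0 /G; case: ifP => _; last by rewrite enc_reductionE.
  by case: ifP => _; first case: ifP.
- move=> x /fyes[pI cI]; have [small|large] := boolP (jc_univ (f x) < N)%N.
    by rewrite ((Gsmall _ pI small).1 cI).
  by have [-> hp hc _] := Glarge _ pI large; split; [|apply: hc].
- move=> x /fno[pI sI]; have [small|large] := boolP (jc_univ (f x) < N)%N.
    have ncI : ~ jc_complete y (f x).
      by case: pI => _ _ I_gt0 _ _; apply: not_complete_sound sI.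
    by rewrite ((Gsmall _ pI small).2 ncI).
  by have [-> hp _ hs] := Glarge _ pI large; split; [|apply: hs].
Qed.
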